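(* Let $\Gamma=(K,I,J,C,D,q,g)$ be a zero-sum repeated game with an informed controller, i.e. satisfying Assumptions 1 and 2 below. Then for every initial distribution $\pi\in\Delta(K\times C\times D)$ with $\pi(E)=1$, the game $\Gamma(\pi)$ has a general uniform value. That is, there exists $v^*(\pi)$ such that for each $\varepsilon>0$ there exist $\alpha>0$ and strategies $\sigma^*$ of player 1 and $\tau^*$ of player 2 such that for all evaluations $\theta$ with $I(\theta)\le\alpha$: - $|v_\theta(\pi)-v^*(\pi)|\le\varepsilon$, - $\gamma_\theta(\pi,\sigma^*,\tau)\ge v^*(\pi)-\varepsilon$ for all strategies $\tau$ of player 2, and - $\gamma_\theta(\pi,\sigma,\tau^* )\le v^*(\pi)+\varepsilon$ for all strategies $\sigma$ of player 1.
   Context: **Model.** $K,I,J,C,D$ are nonempty finite sets (states, actions of players 1 and 2, signals of players 1 and 2); $q:K\times I\times J\to\Delta(K\times C\times D)$ and $g:K\times I\times J\to[0,1]$. **Play of $\Gamma(\pi)$.** $(k_1,c_1,d_1)$ is drawn from $\pi$; player 1 observes $c_1$ and player 2 observes $d_1$. At each stage $t$: - the players simultaneously choose $i_t\in I$ and $j_t\in J$; - player 1 gets the unobserved payoff $g(k_t,i_t,j_t)$ and player 2 gets its opposite; - $(k_{t+1},c_{t+1},d_{t+1})$ is drawn from $q(k_t,i_t,j_t)$, with $c_{t+1}$ told to player 1 and $d_{t+1}$ told to player 2. **Strategies and values.** - Strategies of player 1 are $\sigma_t:(C\times I)^{t-1}\times C\to\Delta(I)$; strategies of player 2 are $\tau_t:(D\times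 J)^{t-1}\times D\to\Delta(J)$. - For an evaluation $\theta\in\Delta(\mathbb N^* )$, $\gamma_\theta(\pi,\sigma,\tau)=\mathbb E_{\pi,\sigma,\tau}\sum_t\theta_tg(k_t,i_t,j_t)$, and $v_\theta(\pi)=\max_\sigma\min_\tau\gamma_\theta=\min_\tau\max_\sigma\gamma_\theta$. - $I(\theta)=\sum_t|\theta_{t+1}-\theta_t|$. **Assumption 1.** There exist maps $\tilde k:C\to K$ and $\tilde d:C\to D$ such that, with $E=\{(k,c,d):\tilde k(c)=k,\ \tilde d(c)=d\}$, we have $q(k,i,j)(E)=1$ for all $(k,i,j)$. **Assumption 2.** The marginal of $q(k,i,j)$ on $K\times D$ does not depend on $j$. *)

(* Defs.v *)
From mathcomp Require Import all_boot.
From Stdlib Require Import Reals ClassicalEpsilon.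

Set Implicit Arguments.
Unset Strict Implicit.
Unset Printing Implicit Defensive.

Local Open Scope R_scope.

Definition fsum (T : finType) (f : T -> R) : R :=
  foldr (fun x acc => f x + acc) 0 (enum T).

Definition is_dist (T : finType) (p : T -> R) : Prop :=
  (forall x, 0 <= p x) /\ fsum p = 1.

(** Sum of a real series (value of the limit of partial sums, when it exists;
    the limit is unique, so this is the usual sum for convergent series). *)
Definition series_sum (u : nat -> R) : R :=
  epsilon (inhabits 0) (fun l => Un_cv (fun N => sum_f_R0 u N) l).

Definition sup_R (P : R -> Prop) : R := epsilon (inhabits 0) (is_lub P).
Definition inf_R (P : R -> Prop) : R := - sup_R (fun x => P (- x)).

Section Game.
Variables (K I J C D : finType).
Variable q : K -> I -> J -> (K * C * D)%type -> R.
Variable g : K -> I -> J -> R.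

(** Behavioural strategies: sigma h c is the mixed action of player 1 after
    the history h = [(c_1,i_1);...;(c_{t-1},i_{t-1})] and current signal c = c_t. *)
Definition strat1 := seq (C * I)%type -> C -> I -> R.
Definition strat2 := seq (D * J)%type -> D -> J -> R.

Definition is_strat1 (sigma : strat1) : Prop :=
  forall h c, is_dist (sigma h c).
Definition is_strat2 (tau : strat2) : Prop :=
  forall h d, is_dist (tau h d).

(** W n x h1 h2 = conditional expected payoff n stages after the current stage,
    given current (state, signal1, signal2) = x and past private histories h1, h2. *)
Fixpoint W (sigma : strat1) (tau : strat2) (n : nat) (x : (K * C * D)%type)
    (h1 : seq (C * I)%type) (h2 : seq (D * J)%type) {struct n} : R :=
  let k := x.1.1 in let c := x.1.2 in let d := x.2 in
  fsum (fun i => fsum (fun j =>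
    sigma h1 c i * tau h2 d j *
    match n with
    | O => g k i j
    | S m => fsum (fun y => q k i j y * W sigma tau m y (rcons h1 (c, i)) (rcons h2 (d, j)))
    end)).

(** Expected payoff at stage n+1: E_{pi,sigma,tau}[ g(k_{n+1}, i_{n+1}, j_{n+1}) ]. *)
Definition stage_payoff (pi : (K * C * D)%type -> R) (sigma : strat1) (tau : strat2)
    (n : nat) : R :=
  fsum (fun x => pi x * W sigma tau n x [::] [::]).

(** Evaluations theta in Delta(positive integers): theta n is the weight of stage n+1. *)
Definition is_evaluation (theta : nat -> R) : Prop :=
  (forall n, 0 <= theta n) /\ Un_cv (fun N => sum_f_R0 theta N) 1.

Definition total_variation (theta : nat -> R) : R :=
  series_sum (fun n => Rabs (theta (S n) - theta n)).

Definition gamma (theta : nat -> R) (pi : (K * C * D)%type -> R)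
    (sigma : strat1) (tau : strat2) : R :=
  series_sum (fun n => theta n * stage_payoff pi sigma tau n).

Definition value (theta : nat -> R) (pi : (K * C * D)%type -> R) : R :=
  sup_R (fun v => exists sigma, is_strat1 sigma /\
    v = inf_R (fun w => exists tau, is_strat2 tau /\ w = gamma theta pi sigma tau)).

Definition in_E (ktil : C -> K) (dtil : C -> D) (x : (K * C * D)%type) : bool :=
  (x.1.1 == ktil x.1.2) && (x.2 == dtil x.1.2).

Definition prob_of (p : (K * C * D)%type -> R) (A : (K * C * D)%type -> bool) : R :=
  fsum (fun x => if A x then p x else 0).

End Game.

(* Main.v *)
Require Import Defs.
From Stdlib Require Import Reals ClassicalEpsilon.
From mathcomp Require Import all_boot all_order all_algebra.
From mathcomp Require Import boolp classical_sets filter reals ring lra Rstruct.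
From Stdlib Require Import Lra Psatz.

Set Implicit Arguments.
Unset Strict Implicit.
Unset Printing Implicit Defensive.

Import Order.TTheory GRing.Theory Num.Theory.

(** Since player 1 knows the state and player 2's signal, and player 2 does not
    influence their joint law, the game reduces to a control problem over flows:
    unnormalised laws [mu h d k i] of (past signals of player 2, current signal,
    state, action of player 1).  Player 2's best reply decouples over the nodes
    [(h, d)], so the stage payoff [rho t mu] is a sum of minima over [j].

    Let [v] be the infimum over [n] of the supremum over starting dates [l] and
    flows of the average of [rho] over the [n] stages following [l].
    - Player 2 guarantees [v]: he plays by blocks of a good length [n], replying
      in each block with a minimax strategy that depends on his signals only;
      replacing a weight by its value at the start of the block costs at most
      [n] times the total variation.
    - Player 1 guarantees [v]: for every probability [theta] on stages, some shift
      of [theta] by [m] stages has value at least [v - eps], by averaging along a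
      flow that is good on a window much longer than [theta].  The value functions
      of all the [theta] are homogeneous and Lipschitz, hence totally bounded, so
      [m] can be bounded by some [M] independent of [theta].  The minimax theorem
      and a compactness argument then give one mixture of flows [mu_m], [m <= M],
      with [sum_m rho (m + t) mu_m >= v - eps] for all [t], and playing this mixture
      costs at most [M] times the total variation. *)

(** * Approximate minimax by regret matching *)

Section FinMin.
Local Open Scope ring_scope.
Variables (R : realType) (J : finType) (j0 : J).

Definition fmin (a : J -> R) : R := a [arg min_(j < j0) a j]%O.

Lemma fmin_le a j : fmin a <= a j.
Proof. by rewrite /fmin; case: arg_minP => // k _; apply. Qed.

Lemma fmin_ex a : exists j, fmin a = a j.
Proof. by exists [arg min_(j < j0) a j]%O. Qed.

Lemma le_fmin a c : (forall j, c <= a j) -> c <= fmin a.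
Proof. by move=> H; apply: H. Qed.

Lemma fminD a b : fmin a + fmin b <= fmin (fun j => a j + b j).
Proof. by apply: le_fmin => j; apply: lerD; apply: fmin_le. Qed.

Lemma fminZ c a : 0 <= c -> fmin (fun j => c * a j) = c * fmin a.
Proof.
move=> c0; apply/eqP; rewrite eq_le; apply/andP; split.
  by have [j ->] := fmin_ex a; apply: (fmin_le (fun j => c * a j)).
by apply: le_fmin => j; apply: ler_wpM2l => //; apply: fmin_le.
Qed.

Lemma eq_fmin a b : a =1 b -> fmin a = fmin b.
Proof. by move=> /funext ->. Qed.

End FinMin.

Section RegretMinimax.
Local Open Scope ring_scope.
Variables (R : realType) (J : finType) (j0 : J) (X : Type).
Variable E : (X -> R) -> R.
Hypothesis E_D : forall F G, E (fun x => F x + G x) = E F + E G.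
Hypothesis E_Z : forall c F, E (fun x => c * F x) = c * E F.
Hypothesis E_le : forall F G, (forall x, F x <= G x) -> E F <= E G.

Definition mixed (f : X -> J -> R) :=
  (forall x j, 0 <= f x j) /\ (forall x, \sum_j f x j = 1).

Variable A : (X -> J -> R) -> Prop.
Hypothesis A01 : forall a, A a -> forall x j, 0 <= a x j <= 1.
Hypothesis A_convex : forall a b l, A a -> A b -> 0 <= l <= 1 ->
  A (fun x j => l * a x j + (1 - l) * b x j).
Variable v : R.
Hypothesis A_response : forall f, mixed f ->
  exists2 a, A a & v <= E (fun x => \sum_j f x j * a x j).

Let pos (r : R) := Num.max r 0.

Lemma sqr_pos_add (r s : R) : pos (r + s) ^+ 2 <= pos r ^+ 2 + 2 * pos r * s + s ^+ 2.
Proof.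
have H : pos r ^+ 2 + 2 * pos r * s + s ^+ 2 = (pos r + s) ^+ 2 by ring.
rewrite H /pos; case: (leP (r + s) 0) => rs; first by rewrite expr0n /= sqr_ge0.
by case: (leP r 0) => r0; rewrite ?lexx // add0r ler_sqr ?nnegrE; lra.
Qed.

Definition regret_match (r : X -> J -> R) x j :=
  if \sum_j' pos (r x j') == 0 then (j == j0)%:R
  else pos (r x j) / \sum_j' pos (r x j').

Lemma pos_ge0 r : 0 <= pos r. Proof. by rewrite /pos le_max lexx orbT. Qed.

Lemma regret_match_mixed r : mixed (regret_match r).
Proof.
split=> [x j|x]; rewrite /regret_match; case: eqP => [_|/eqP n0].
- by rewrite ler0n.
- by rewrite divr_ge0 ?sumr_ge0 // => *; rewrite pos_ge0.
- by rewrite (bigD1 j0) //= eqxx big1 ?addr0 // => j /negbTE ->.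
by rewrite -mulr_suml divff.
Qed.

(* Regret matching makes the increment orthogonal to the positive part of the regret. *)
Lemma regret_match_orthogonal r (b : X -> J -> R) x :
  \sum_j pos (r x j) * (\sum_j' regret_match r x j' * b x j' - b x j) = 0.
Proof.
rewrite /regret_match; case: eqP => [s0|/eqP n0].
  have p0 j : pos (r x j) = 0.
    apply/eqP; have /eqP := s0; rewrite psumr_eq0 => [/allP /(_ j)|*]; last exact: pos_ge0.
    by rewrite mem_index_enum => /(_ isT).
  by apply: big1 => j _; rewrite p0 mul0r.
under eq_bigr => j _ do rewrite mulrBr.
rewrite sumrB -mulr_suml; apply/eqP; rewrite subr_eq0; apply/eqP.
rewrite mulr_sumr; apply: eq_bigr => j _.
by field.
Qed.

(* [c x] is the total payoff realised at [x] in [S] rounds, [a] the average reply,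
   so that [c x - S a x j] is the regret for not having played [j]. *)
Lemma regret_run (S : nat) : exists a c, [/\ A a, S%:R * v <= E c &
  E (fun x => \sum_j pos (c x - S%:R * a x j) ^+ 2) <= S%:R * (#|J|%:R * E (fun=> 1))].
Proof.
have E0 : E (fun=> 0) = 0.
  by have := E_Z 0 (fun=> 0); rewrite !mul0r.
elim: S => [|S [a [c [Aa vc Phi]]]].
  have [a Aa _] := A_response (regret_match_mixed (fun _ _ => 0)).
  exists a, (fun=> 0); split; rewrite ?mul0r ?E0 //.
  rewrite -[X in _ <= X]E0; apply: E_le => x; apply: sumr_le0 => j _.
  by rewrite mul0r subrr /pos maxxx expr0n.
pose r x j := c x - S%:R * a x j.
pose f := regret_match r.
have fB : mixed f by apply: regret_match_mixed.
have [f0 f1] := fB.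
have [b Ab vb] := A_response fB.
exists (fun x j => S%:R / S.+1%:R * a x j + (1 - S%:R / S.+1%:R) * b x j).
exists (fun x => c x + \sum_j f x j * b x j); split.
- apply: A_convex => //; rewrite divr_ge0 //= ler_pdivrMr ?ltr0n // mul1r ler_nat; exact: leqnSn.
- by rewrite E_D -natr1 mulrDl mul1r lerD.
pose d x j := \sum_j' f x j' * b x j' - b x j.
have d1 x j : d x j ^+ 2 <= 1.
  have s0 : 0 <= \sum_j' f x j' * b x j'.
    by apply: sumr_ge0 => j' _; rewrite mulr_ge0 //; case/andP: (A01 Ab x j').
  have s1 : \sum_j' f x j' * b x j' <= 1.
    rewrite -(f1 x); apply: ler_sum => j' _; rewrite ler_piMr //.
    by case/andP: (A01 Ab x j').
  case/andP: (A01 Ab x j) => b0 b1.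
  rewrite -real_normK ?num_real // expr_le1 // ler_norml /d; apply/andP; split; lra.
have step x : \sum_j pos (c x + \sum_j' f x j' * b x j' -
    S.+1%:R * (S%:R / S.+1%:R * a x j + (1 - S%:R / S.+1%:R) * b x j)) ^+ 2 <=
    \sum_j pos (r x j) ^+ 2 + #|J|%:R * 1.
  apply: (@le_trans _ _ (\sum_j (pos (r x j) ^+ 2 + 2 * (pos (r x j) * d x j) + d x j ^+ 2))).
    apply: ler_sum => j _.
    have -> : c x + \sum_j' f x j' * b x j' -
       S.+1%:R * (S%:R / S.+1%:R * a x j + (1 - S%:R / S.+1%:R) * b x j) = r x j + d x j.
      rewrite /r /d; set u := \sum_j' _; rewrite -natr1.
      have n0 : (S%:R + 1 : R) != 0 by rewrite natr1 pnatr_eq0.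
      by field.
    by rewrite mulrA sqr_pos_add.
  rewrite !big_split /= -mulr_sumr regret_match_orthogonal mulr0 addr0 lerD2l mulr1.
  apply: (le_trans (ler_sum _ (fun j _ => d1 x j))).
  by rewrite sumr_const.
apply: (le_trans (E_le step)).
by rewrite E_D E_Z -natr1 mulrDl mul1r lerD2r.
Qed.

Lemma regret_minimax e : 0 < e -> exists2 a, A a & v - e <= E (fun x => fmin j0 (a x)).
Proof.
move=> e0.
pose B := E (fun=> 1).
have B0 : 0 <= B.
  have : 0 * B <= 1 * B.
    by rewrite -!E_Z; apply: E_le => x; rewrite mul0r mul1r.
  by rewrite mul0r mul1r.
pose C := #|J|%:R * B.
have C0 : 0 <= C by rewrite mulr_ge0.
pose dl := e / (2 * (B + 1)).
have dl0 : 0 < dl by rewrite divr_gt0 // mulr_gt0 // ltr_wpDl.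
have dlB : dl * B <= e / 2.
  have B1 : 0 < B + 1 by rewrite ltr_wpDl.
  have -> : dl * B = e / 2 * (B / (B + 1)) by rewrite /dl; field; rewrite gt_eqF.
  by rewrite ler_piMr ?ler_pdivrMr ?mul1r ?lerDl // ltW // divr_gt0.
have [S S1 SC] : exists2 S : nat, (0 < S)%N & C / dl <= e / 2 * S%:R.
  exists (Num.bound (C / dl / (e / 2))).+1 => //.
  rewrite [leRHS]mulrC -ler_pdivrMr ?divr_gt0 //.
  have /archi_boundP/ltW bnd : 0 <= C / dl / (e / 2).
    by apply: divr_ge0; [apply: divr_ge0 => //; exact: ltW | rewrite divr_ge0 // ltW].
  by apply: (le_trans bnd); rewrite ler_nat.
have [a [c [Aa vc Phi]]] := regret_run S.
exists a => //.
have S0 : 0 < S%:R :> R by rewrite ltr0n.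
rewrite -(ler_pM2l S0).
have key x : c x <= S%:R * fmin j0 (a x) + (S%:R * dl * 1 +
    (S%:R * dl)^-1 * \sum_j pos (c x - S%:R * a x j) ^+ 2).
  have [j ->] := fmin_ex j0 (a x).
  have h0 : 0 < S%:R * dl by rewrite mulr_gt0.
  pose r := c x - S%:R * a x j; suff : r <= S%:R * dl + (S%:R * dl)^-1 * pos r ^+ 2.
    move=> rle; have : \sum_j pos (c x - S%:R * a x j) ^+ 2 >= pos r ^+ 2.
      by rewrite (bigD1 j) //= lerDl sumr_ge0 // => *; rewrite sqr_ge0.
    move=> /(ler_wpM2l (ltW (_ : 0 < (S%:R * dl)^-1))); rewrite invr_gt0 => /(_ h0).
    rewrite /r in rle *; lra.
  have [r0|r0] := leP r (S%:R * dl).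
    by apply: (le_trans r0); rewrite lerDl mulr_ge0 ?sqr_ge0 ?invr_ge0 ?ltW.
  have r1 : 0 < r by exact: lt_trans r0.
  rewrite /pos max_l; last exact: ltW.
  apply: ltW; apply: ltr_wpDl; first exact: ltW.
  by rewrite mulrC ltr_pdivlMr // expr2 ltr_pM2l.
have := E_le key; rewrite !E_D !E_Z -/B => cle.
have : (S%:R * dl)^-1 * E (fun x => \sum_j pos (c x - S%:R * a x j) ^+ 2) <= S%:R * (e / 2).
  apply: (@le_trans _ _ ((S%:R * dl)^-1 * (S%:R * C))).
    by rewrite ler_wpM2l // invr_ge0 mulr_ge0 // ltW.
  have -> : (S%:R * dl)^-1 * (S%:R * C) = C / dl.
    by field; rewrite !gt_eqF.
  by rewrite [leRHS]mulrC.
have := ler_wpM2l (ltW S0) dlB.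
nra.
Qed.

End RegretMinimax.

(** * Sums over signal histories and ultrafilter limits *)

Section HistorySums.
Local Open Scope ring_scope.
Variables (R : realType) (D : finType).
Implicit Types F G : seq D -> R.

Fixpoint hsum n F : R := if n is n'.+1 then \sum_d hsum n' (fun h => F (d :: h)) else F [::].

Lemma eq_hsum n F G : (forall h, size h = n -> F h = G h) -> hsum n F = hsum n G.
Proof.
elim: n F G => [|n IH] F G FG /=; first exact: FG.
by apply: eq_bigr => d _; apply: IH => h hn; apply: FG; rewrite /= hn.
Qed.

Lemma ler_hsum n F G : (forall h, size h = n -> F h <= G h) -> hsum n F <= hsum n G.
Proof.
elim: n F G => [|n IH] F G FG /=; first exact: FG.
by apply: ler_sum => d _; apply: IH => h hn; apply: FG; rewrite /= hn.
Qed.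

Lemma hsumD n F G : hsum n (fun h => F h + G h) = hsum n F + hsum n G.
Proof.
elim: n F G => [|n IH] F G //=.
by rewrite -big_split /=; apply: eq_bigr => d _; rewrite IH.
Qed.

Lemma hsumZ n c F : hsum n (fun h => c * F h) = c * hsum n F.
Proof.
elim: n F => [|n IH] F //=.
by rewrite mulr_sumr; apply: eq_bigr => d _; rewrite IH.
Qed.

Lemma hsum_ge0 n F : (forall h, 0 <= F h) -> 0 <= hsum n F.
Proof. by elim: n F => [|n IH] F F0 //=; apply: sumr_ge0 => d _; apply: IH. Qed.

Lemma hsum_sum n (T : finType) (F : T -> seq D -> R) :
  hsum n (fun h => \sum_x F x h) = \sum_x hsum n (F x).
Proof.
elim: n F => [|n IH] F //=.
by rewrite exchange_big /=; apply: eq_bigr => d _; rewrite IH.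
Qed.

Lemma hsum_cat m n F : hsum (m + n) F = hsum m (fun h => hsum n (fun h' => F (h ++ h'))).
Proof. by elim: m F => [|m IH] F //=; apply: eq_bigr => d _; rewrite IH. Qed.

Lemma hsum_rcons n F : hsum n.+1 F = hsum n (fun h => \sum_d F (rcons h d)).
Proof.
by rewrite -addn1 hsum_cat; apply: eq_hsum => h _ /=; apply: eq_bigr => d _; rewrite cats1.
Qed.

End HistorySums.

Section UltraLimits.
Local Open Scope ring_scope.
Local Open Scope classical_set_scope.
Variables (R : realType) (U : set_system nat).
Hypothesis UU : UltraFilter U.
Hypothesis U_oo : forall N, U [set n | (N <= n)%N].
Implicit Types u v : nat -> R.

Definition ucv u (l : R) := forall e, 0 < e -> U [set n | `|u n - l| < e].

Lemma ucvD u v l l' : ucv u l -> ucv v l' -> ucv (fun n => u n + v n) (l + l').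
Proof.
move=> ul vl e e0; have e2 : 0 < e / 2 by rewrite divr_gt0.
apply: filterS2 (ul _ e2) (vl _ e2) => n /= h1 h2.
rewrite opprD addrACA; apply: le_lt_trans (ler_normD _ _) _; lra.
Qed.

Lemma ucv_cst c : ucv (fun=> c) c.
Proof. by move=> e e0; apply: filterS filterT => n _ /=; rewrite subrr normr0. Qed.

Lemma ucvZ c u l : ucv u l -> ucv (fun n => c * u n) (c * l).
Proof.
move=> ul e e0; have c1 : 0 < `|c| + 1 by rewrite ltr_wpDl.
have ec : 0 < e / (`|c| + 1) by rewrite divr_gt0.
apply: filterS (ul _ ec) => n /=; rewrite -mulrBr normrM ltr_pdivlMr // => h.
apply: le_lt_trans h; rewrite mulrC ler_wpM2l // lerDl //.
Qed.

Lemma ucv_sum (T : finType) (u : T -> nat -> R) l :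
  (forall x, ucv (u x) (l x)) -> ucv (fun n => \sum_x u x n) (\sum_x l x).
Proof.
move=> ul; elim: (index_enum T) => [|x s IH].
  by rewrite big_nil; under eq_fun do rewrite big_nil; apply: ucv_cst.
by rewrite big_cons; under eq_fun do rewrite big_cons; apply: ucvD.
Qed.

Lemma ucv_hsum (D : finType) t (u : seq D -> nat -> R) l :
  (forall h, ucv (u h) (l h)) -> ucv (fun n => hsum t (fun h => u h n)) (hsum t l).
Proof.
by elim: t u l => [|t IH] u l ul //=; apply: ucv_sum => d; apply: IH.
Qed.

Lemma ucv_ge u l c N : ucv u l -> (forall n, (N <= n)%N -> c <= u n) -> c <= l.
Proof.
move=> ul cu; rewrite leNgt; apply/negP => lc.
have e0 : 0 < c - l by rewrite subr_gt0.
have [n /= [h1 h2]] := filter_ex (filterI (ul _ e0) (U_oo N)).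
have := cu n h2; have := ler_norm (u n - l); lra.
Qed.

Lemma ucv_unique u l l' : ucv u l -> ucv u l' -> l = l'.
Proof.
move=> ul ul'; have := ucvD ul (ucvZ (-1) ul').
have -> : (fun n => u n + -1 * u n) = fun=> 0 by apply/funext => n; ring.
move=> H; apply/eqP; rewrite eq_le.
have H' := ucvZ (-1) H.
have h1 := ucv_ge (N := 0) (c := 0) H (fun n _ => lexx _).
have h2 : 0 <= -1 * (l + -1 * l').
  by apply: (ucv_ge (N := 0) H') => n _; rewrite mulr0.
apply/andP; split; lra.
Qed.

Lemma ucv_ex u : (forall n, 0 <= u n <= 1) -> exists l, ucv u l.
Proof.
move=> u01; pose S := [set x | U [set n | x <= u n]].
have hs : has_sup S.
  split; first by exists 0; apply: filterS filterT => n _ /=; case/andP: (u01 n).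
  exists 1 => x /filter_ex [n /= xn]; apply: (le_trans xn); by case/andP: (u01 n).
exists (sup S) => e e0; have [x Sx lx] := sup_adherent e0 hs.
have nS : ~ S (sup S + e / 2).
  move=> /(sup_upper_bound hs); lra.
have [//|Uc] := in_ultra_setVsetC [set n | sup S + e / 2 <= u n] UU.
apply: filterS2 Sx Uc => n /= h1 /negP; rewrite -ltNge => h2.
rewrite ltr_norml; apply/andP; split; lra.
Qed.

End UltraLimits.

Lemma ultra_eventually : exists2 U : set_system nat, UltraFilter U &
  forall N, U [set n | (N <= n)%N]%classic.
Proof.
have [U [UU sub]] := ultraFilterLemma (eventually_filter : ProperFilter \oo%classic).
by exists U => // N; apply: sub; exists N.
Qed.

Section Variation.
Local Open Scope ring_scope.
Variables (R : realType) (th : nat -> R) (B : R).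
Hypothesis th0 : forall t, 0 <= th t.
Hypothesis thB : forall N, \sum_(t < N) `|th t.+1 - th t| <= B.

Lemma sum_ord_add (F : nat -> R) m n :
  \sum_(t < m + n) F t = \sum_(t < m) F t + \sum_(t < n) F (m + t)%N.
Proof. by rewrite big_split_ord. Qed.

Lemma sum_ord_le (F : nat -> R) m n : (m <= n)%N -> (forall t, 0 <= F t) ->
  \sum_(t < m) F t <= \sum_(t < n) F t.
Proof.
by move=> /subnKC <- F0; rewrite sum_ord_add lerDl sumr_ge0.
Qed.

Lemma tv_shift m T : \sum_(t < T) `|th (m + t)%N - th t| <= m%:R * B.
Proof.
elim: m => [|m IH]; first by rewrite mul0r big1 // => t _; rewrite subrr normr0.
rewrite -natr1 mulrDl mul1r.
apply: (@le_trans _ _ (\sum_(t < T) (`|th (m + t)%N - th t| + `|th (m + t).+1 - th (m + t)%N|))).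
  apply: ler_sum => t _; rewrite addSn [leRHS]addrC.
  by apply: le_trans (ler_normD _ _); rewrite addrA subrK.
rewrite big_split /=; apply: lerD => //; apply: le_trans (thB (m + T)).
by rewrite (sum_ord_add (fun t => `|th t.+1 - th t|)) lerDr sumr_ge0.
Qed.

Lemma var_le l s n : (s <= n)%N ->
  `|th (l + s)%N - th l| <= \sum_(u < n) `|th (l + u).+1 - th (l + u)%N|.
Proof.
pose F u := `|th (l + u).+1 - th (l + u)%N|.
move=> sn; apply: le_trans (sum_ord_le (F := F) sn (fun u => normr_ge0 _)); rewrite /F.
elim: s {sn} => [|s IH]; first by rewrite addn0 subrr normr0 big_ord0.
rewrite big_ord_recr /= [leRHS]addrC; apply: le_trans (lerD (lexx _) IH).
by apply: le_trans (ler_normD _ _); rewrite addrA subrK addnS.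
Qed.

Lemma block_sum (p : nat -> R) n c b : 0 <= c -> (forall t, 0 <= p t <= 1) ->
  (forall b, \sum_(s < n) p (b * n + s)%N <= n%:R * c) ->
  \sum_(s < b * n) th s * p s <= c * \sum_(s < b * n) th s + (1 + c) * n%:R * B.
Proof.
move=> c0 p01 pb.
suff H : \sum_(s < b * n) th s * p s <= c * \sum_(s < b * n) th s +
    (1 + c) * n%:R * \sum_(s < b * n) `|th s.+1 - th s|.
  apply: (le_trans H); rewrite lerD2l ler_wpM2l //.
  by rewrite mulr_ge0 // addr_ge0.
elim: b => [|b IH]; first by rewrite !big_ord0 !mulr0 addr0.
rewrite mulSn addnC !(sum_ord_add (fun s => th s * p s)) (sum_ord_add th).
rewrite (sum_ord_add (fun s => `|th s.+1 - th s|)).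
set l := (b * n)%N in IH *; set V := \sum_(t < n) `|_|.
suff : \sum_(t < n) th (l + t)%N * p (l + t)%N <= c * \sum_(t < n) th (l + t)%N + (1 + c) * n%:R * V.
  by move=> h; move: (lerD IH h); rewrite !mulrDr; lra.
have aV t : (t < n)%N -> `|th (l + t)%N - th l| <= V by move=> tn; apply/var_le/ltnW.
have s1 : \sum_(t < n) th (l + t)%N * p (l + t)%N <= th l * (n%:R * c) + n%:R * V.
  apply: (@le_trans _ _ (\sum_(t < n) (th l * p (l + t)%N + V))).
    apply: ler_sum => t _; have /andP[q0 q1] := p01 (l + t)%N.
    have := aV t (ltn_ord t); rewrite ler_norml => /andP[_ h].
    have V0 : 0 <= V by apply: sumr_ge0.
    nra.
  rewrite big_split /= -mulr_sumr sumr_const card_ord -[V *+ n]mulr_natl lerD2r.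
  by apply: ler_wpM2l => //; apply: pb.
have s2 : n%:R * th l <= \sum_(t < n) th (l + t)%N + n%:R * V.
  apply: (@le_trans _ _ (\sum_(t < n) (th (l + t)%N + V))); last first.
    by rewrite big_split /= sumr_const card_ord -[V *+ n]mulr_natl.
  rewrite mulr_natl -[n in _ *+ n]card_ord -sumr_const; apply: ler_sum => t _.
  have := aV t (ltn_ord t); rewrite ler_norml => /andP[h _]; lra.
have := ler_wpM2l c0 s2; move: s1; rewrite !mulrDr !mulrDl; lra.
Qed.

End Variation.

(** * The control problem over flows *)

Section Flows.
Local Open Scope ring_scope.
Variables (R : realType) (K I J D : finType) (i0 : I) (j0 : J).
Variable Q : K -> I -> D -> K -> R.
Variable g : K -> I -> J -> R.
Hypothesis Q_ge0 : forall k i d k', 0 <= Q k i d k'.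
Hypothesis Q_sum : forall k i, \sum_d \sum_k' Q k i d k' = 1.
Hypothesis g01 : forall k i j, 0 <= g k i j <= 1.

Implicit Types (P : D -> K -> R) (mu nu : seq D -> D -> K -> I -> R).

Definition marg (m : D -> K -> I -> R) d k := \sum_i m d k i.
Definition nxt (m : D -> K -> I -> R) d d' k' := \sum_k \sum_i m d k i * Q k i d' k'.
Definition mass P := \sum_d \sum_k P d k.

(* [mu h d k i] is the (unnormalised) probability that player 2's past signals
   are [h], his current signal is [d], the state is [k] and player 1 plays [i]. *)
Definition flow P mu := [/\ forall h d k i, 0 <= mu h d k i,
  forall d k, marg (mu [::]) d k = P d k &
  forall h d d' k', marg (mu (rcons h d)) d' k' = nxt (mu h) d d' k'].

Lemma flowD P P' mu mu' : flow P mu -> flow P' mu' ->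
  flow (fun d k => P d k + P' d k) (fun h d k i => mu h d k i + mu' h d k i).
Proof.
move=> [p0 pr ps] [p0' pr' ps']; split=> [h d k i|d k|h d d' k'].
- by rewrite addr_ge0.
- by rewrite /marg big_split -pr -pr'.
rewrite /marg big_split /= [X in X + _]ps [X in _ + X]ps' /nxt -big_split /=.
by apply: eq_bigr => k _; rewrite -big_split; apply: eq_bigr => i _; rewrite mulrDl.
Qed.

Lemma flowZ c P mu : 0 <= c -> flow P mu ->
  flow (fun d k => c * P d k) (fun h d k i => c * mu h d k i).
Proof.
move=> c0 [p0 pr ps]; split=> [h d k i|d k|h d d' k'].
- by rewrite mulr_ge0.
- by rewrite /marg -mulr_sumr -pr.
rewrite /marg -mulr_sumr [X in _ * X]ps /nxt mulr_sumr.
by apply: eq_bigr => k _; rewrite mulr_sumr; apply: eq_bigr => i _; rewrite mulrA.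
Qed.

Lemma flowB P P' mu mu' : flow P mu -> flow P' mu' ->
  (forall h d k i, mu' h d k i <= mu h d k i) ->
  flow (fun d k => P d k - P' d k) (fun h d k i => mu h d k i - mu' h d k i).
Proof.
move=> [p0 pr ps] [p0' pr' ps'] le; split=> [h d k i|d k|h d d' k'].
- by rewrite subr_ge0.
- by rewrite /marg sumrB -pr -pr'.
rewrite /marg sumrB /= [X in X - _]ps [X in _ - X]ps' /nxt -sumrB /=.
by apply: eq_bigr => k _; rewrite -sumrB; apply: eq_bigr => i _; rewrite mulrBl.
Qed.

Lemma flow_ext P P' mu : (forall d k, P d k = P' d k) -> flow P mu -> flow P' mu.
Proof. by move=> e [p0 pr ps]; split=> // d k; rewrite pr. Qed.

Lemma flow_sub P mu h0 : flow P mu -> flow (marg (mu h0)) (fun h => mu (h0 ++ h)).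
Proof.
move=> [p0 pr ps]; split=> [h d k i //|d k|h d d' k']; first by rewrite cats0.
by rewrite -rcons_cat ps.
Qed.

Lemma mass_nxt m : \sum_d mass (nxt m d) = mass (marg m).
Proof.
apply: eq_bigr => d _; rewrite /mass /nxt.
under eq_bigr => d' _ do rewrite exchange_big /=.
rewrite exchange_big /=; apply: eq_bigr => k _.
under eq_bigr => d' _ do rewrite exchange_big /=.
rewrite exchange_big /=; apply: eq_bigr => i _.
under eq_bigr => d' _ do rewrite -mulr_sumr.
by rewrite -mulr_sumr Q_sum mulr1.
Qed.

Lemma flow_mass P mu t : flow P mu -> hsum t (fun h => mass (marg (mu h))) = mass P.
Proof.
move=> [p0 pr ps]; elim: t => [|t IH].
  by apply: eq_bigr => d _; apply: eq_bigr => k _; rewrite pr.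
rewrite hsum_rcons -IH; apply: eq_hsum => h _; rewrite -mass_nxt.
apply: eq_bigr => d _; apply: eq_bigr => d' _; apply: eq_bigr => k' _; exact: ps.
Qed.

Lemma marg_ge0 m : (forall d k i, 0 <= m d k i) -> forall d k, 0 <= marg m d k.
Proof. by move=> m0 d k; apply: sumr_ge0. Qed.

Lemma mass_ge0 P : (forall d k, 0 <= P d k) -> 0 <= mass P.
Proof. by move=> P0; apply: sumr_ge0 => d _; apply: sumr_ge0. Qed.

Lemma le_mass P P' : (forall d k, P d k <= P' d k) -> mass P <= mass P'.
Proof. by move=> le; apply: ler_sum => d _; apply: ler_sum. Qed.

Lemma flow_mass_le P mu h : flow P mu -> mass (marg (mu h)) <= mass P.
Proof.
move=> [p0 pr ps]; elim/last_ind: h => [|h d IH]; first by apply: le_mass => d k; rewrite pr.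
apply: le_trans IH; rewrite -(mass_nxt (mu h)) (bigD1 d) //= -[leLHS]addr0 lerD //.
  by apply: le_mass => d' k'; rewrite ps.
apply: sumr_ge0 => d' _; apply: mass_ge0 => d'' k''.
by apply: sumr_ge0 => k _; apply: sumr_ge0 => i _; rewrite mulr_ge0.
Qed.

Fixpoint reach (x : seq D -> D -> K -> I -> R) P h : D -> K -> R :=
  if h is d :: h' then
    reach (fun h => x (d :: h)) (nxt (fun d k i => P d k * x [::] d k i) d) h'
  else P.

Definition flow_of x P h d k i := reach x P h d k * x h d k i.

Definition behaviour1 (x : seq D -> D -> K -> I -> R) :=
  (forall h d k i, 0 <= x h d k i) /\ (forall h d k, \sum_i x h d k i = 1).

Lemma reach_rcons x P h d d' k' : reach x P (rcons h d) d' k' = nxt (flow_of x P h) d d' k'.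
Proof. by elim: h x P => [|d1 h IH] x P //=; rewrite IH. Qed.

Lemma nxt_ge0 m d : (forall d k i, 0 <= m d k i) -> forall d' k', 0 <= nxt m d d' k'.
Proof. by move=> m0 d' k'; apply: sumr_ge0 => k _; apply: sumr_ge0 => i _; rewrite mulr_ge0. Qed.

Lemma ler_nxt m m' d : (forall d k i, m d k i <= m' d k i) ->
  forall d' k', nxt m d d' k' <= nxt m' d d' k'.
Proof.
by move=> m0 d' k'; apply: ler_sum => k _; apply: ler_sum => i _; rewrite ler_wpM2r.
Qed.

Lemma reach_ge0 x P : behaviour1 x -> (forall d k, 0 <= P d k) -> forall h d k, 0 <= reach x P h d k.
Proof.
move=> xB P0 h; elim: h x P xB P0 => [|d1 h IH] x P xB P0 d k //=.
apply: IH; first by case: xB => x0 x1; split.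
by move=> d' k'; apply: nxt_ge0 => *; rewrite mulr_ge0 //; case: xB.
Qed.

Lemma ler_reach x P P' : behaviour1 x -> (forall d k, P d k <= P' d k) ->
  forall h d k, reach x P h d k <= reach x P' h d k.
Proof.
move=> xB P0 h; elim: h x P P' xB P0 => [|d1 h IH] x P P' xB P0 d k //=.
apply: IH; first by case: xB => x0 x1; split.
by move=> d' k'; apply: ler_nxt => *; rewrite ler_wpM2r //; case: xB.
Qed.

Lemma flow_of_flow x P : behaviour1 x -> (forall d k, 0 <= P d k) -> flow P (flow_of x P).
Proof.
move=> xB P0; have [x0 x1] := xB; split=> [h d k i|d k|h d d' k'].
- by rewrite mulr_ge0 // reach_ge0.
- by rewrite /marg -mulr_sumr x1 mulr1.
by rewrite /marg -mulr_sumr x1 mulr1 reach_rcons.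
Qed.

Definition cond_action mu h d k i : R :=
  if marg (mu h) d k == 0 then (i == i0)%:R else mu h d k i / marg (mu h) d k.

Lemma cond_action_behaviour P mu : flow P mu -> behaviour1 (cond_action mu).
Proof.
move=> [p0 _ _]; split=> [h d k i|h d k]; rewrite /cond_action; case: eqP => [_|/eqP n0].
- by rewrite ler0n.
- by rewrite divr_ge0 // sumr_ge0.
- by rewrite (bigD1 i0) //= eqxx big1 ?addr0 // => i /negbTE ->.
by rewrite -mulr_suml divff.
Qed.

Lemma flow_cond_action P mu h d k i : flow P mu ->
  mu h d k i = marg (mu h) d k * cond_action mu h d k i.
Proof.
move=> [p0 _ _]; rewrite /cond_action; case: eqP => [m0|/eqP n0]; last by rewrite mulrC divfK.
rewrite m0 mul0r; apply/eqP; have /eqP := m0; rewrite psumr_eq0 // => /allP /(_ i).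
by rewrite mem_index_enum => /(_ isT).
Qed.

Lemma flow_of_cond_action P mu : flow P mu -> flow_of (cond_action mu) P = mu.
Proof.
move=> fl; have [p0 pr ps] := fl; apply/funext => h.
suff reachE : reach (cond_action mu) P h = marg (mu h).
  by do 3 apply/funext => ?; rewrite /flow_of reachE -(flow_cond_action _ _ _ _ fl).
elim/last_ind: h => [|h d IH]; first by do 2 apply/funext => ?; rewrite pr.
do 2 apply/funext => ?; rewrite reach_rcons ps; congr nxt.
by do 3 apply/funext => ?; rewrite /flow_of IH -(flow_cond_action _ _ _ _ fl).
Qed.

Lemma flow_ex P : (forall d k, 0 <= P d k) -> exists mu, flow P mu.
Proof.
move=> P0; exists (flow_of (fun _ _ _ i => (i == i0)%:R) P); apply: flow_of_flow => //.
by split=> *; rewrite ?ler0n // (bigD1 i0) //= eqxx big1 ?addr0 // => i /negbTE ->.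
Qed.

Lemma flow_restrict P P' mu : flow P mu -> (forall d k, 0 <= P' d k <= P d k) ->
  exists2 nu, flow P' nu & forall h d k i, nu h d k i <= mu h d k i.
Proof.
move=> fl PP; have xB := cond_action_behaviour fl.
exists (flow_of (cond_action mu) P'); first by apply: flow_of_flow => // d k; case/andP: (PP d k).
move=> h d k i; rewrite -[in leRHS](flow_of_cond_action fl) ler_wpM2r //; first by case: xB.
by apply: ler_reach => // d' k'; case/andP: (PP d' k').
Qed.

Lemma flow_splice P mu (m : nat) (nu : seq D -> seq D -> D -> K -> I -> R) : flow P mu ->
  (forall h, flow (marg (mu h)) (nu h)) ->
  flow P (fun h => if (size h < m)%N then mu h else nu (take m h) (drop m h)).
Proof.
move=> [p0 pr ps] fn; split=> [h d k i|d k|h d d' k'].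
- by case: ifP => // _; case: (fn (take m h)).
- case: ifP => _; first exact: pr.
  by case: (fn [::]) => _ nr _; rewrite /= nr pr.
rewrite size_rcons; have [lt|ge] := ltnP (size h).+1 m; first by rewrite ltnW.
case: (fn (take m h)) => _ _ ns; have [lt|ge'] := ltnP (size h) m.
  have -> : m = size (rcons h d) by rewrite size_rcons; apply/eqP; rewrite eqn_leq lt ge.
  rewrite take_size drop_size; case: (fn (rcons h d)) => _ nr _.
  by rewrite nr ps.
have -> : drop m (rcons h d) = rcons (drop m h) d.
  rewrite -!cats1 drop_cat; case: ltngtP ge' => // e _.
  by rewrite e subnn drop0 drop_size.
by rewrite -[in take m (rcons h d)]cats1 takel_cat // ns.
Qed.

Definition cost (m : D -> K -> I -> R) d j := \sum_k \sum_i m d k i * g k i j.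
Definition node_rho (m : D -> K -> I -> R) := \sum_d fmin j0 (cost m d).
Definition rho t mu := hsum t (fun h => node_rho (mu h)).
Definition pay (f : seq D -> D -> J -> R) t mu :=
  hsum t (fun h => \sum_d \sum_j f h d j * cost (mu h) d j).

Lemma cost_ge0 m d j : (forall d k i, 0 <= m d k i) -> 0 <= cost m d j.
Proof.
move=> m0; apply: sumr_ge0 => k _; apply: sumr_ge0 => i _; rewrite mulr_ge0 //.
by case/andP: (g01 k i j).
Qed.

Lemma cost_le m d j : (forall d k i, 0 <= m d k i) -> cost m d j <= \sum_k marg m d k.
Proof.
move=> m0; apply: ler_sum => k _; apply: ler_sum => i _; rewrite ler_piMr //.
by case/andP: (g01 k i j).
Qed.

Lemma costD m m' d j : cost (fun d k i => m d k i + m' d k i) d j = cost m d j + cost m' d j.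
Proof.
rewrite /cost -big_split; apply: eq_bigr => k _; rewrite -big_split.
by apply: eq_bigr => i _; rewrite mulrDl.
Qed.

Lemma costZ c m d j : cost (fun d k i => c * m d k i) d j = c * cost m d j.
Proof.
rewrite /cost mulr_sumr; apply: eq_bigr => k _; rewrite mulr_sumr.
by apply: eq_bigr => i _; rewrite mulrA.
Qed.

Lemma node_rhoD m m' : node_rho m + node_rho m' <= node_rho (fun d k i => m d k i + m' d k i).
Proof.
rewrite /node_rho -big_split /=; apply: ler_sum => d _.
by apply: le_trans (fminD _ _ _) _; rewrite le_eqVlt; apply/orP; left;
  apply/eqP/eq_fmin => j; rewrite costD.
Qed.

Lemma node_rhoZ c m : 0 <= c -> node_rho (fun d k i => c * m d k i) = c * node_rho m.
Proof.
move=> c0; rewrite /node_rho mulr_sumr; apply: eq_bigr => d _; rewrite -fminZ //.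
by apply: eq_fmin => j; rewrite costZ.
Qed.

Lemma node_rho_ge0 m : (forall d k i, 0 <= m d k i) -> 0 <= node_rho m.
Proof. by move=> m0; apply: sumr_ge0 => d _; apply: le_fmin => j; apply: cost_ge0. Qed.

Lemma node_rho_le m : (forall d k i, 0 <= m d k i) -> node_rho m <= mass (marg m).
Proof.
by move=> m0; apply: ler_sum => d _; apply: le_trans (fmin_le _ _ j0) _; apply: cost_le.
Qed.

Lemma node_rho_leD m m' : (forall d k i, 0 <= m' d k i) ->
  node_rho (fun d k i => m d k i + m' d k i) <= node_rho m + mass (marg m').
Proof.
move=> m0; rewrite /node_rho -big_split; apply: ler_sum => d _ /=.
have [j ->] := fmin_ex j0 (cost m d).
apply: le_trans (fmin_le _ _ j) _; rewrite costD lerD2l; exact: cost_le.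
Qed.

Lemma rhoD t mu nu : rho t mu + rho t nu <= rho t (fun h d k i => mu h d k i + nu h d k i).
Proof. by rewrite /rho -hsumD; apply: ler_hsum => h _; apply: node_rhoD. Qed.

Lemma rhoZ t c mu : 0 <= c -> rho t (fun h d k i => c * mu h d k i) = c * rho t mu.
Proof. by move=> c0; rewrite /rho -hsumZ; apply: eq_hsum => h _; apply: node_rhoZ. Qed.

Lemma rho_ge0 P t mu : flow P mu -> 0 <= rho t mu.
Proof. by move=> [p0 _ _]; apply: hsum_ge0 => h; apply: node_rho_ge0. Qed.

Lemma rho_le P t mu : flow P mu -> rho t mu <= mass P.
Proof.
move=> fl; rewrite -(flow_mass t fl); case: fl => p0 _ _.
by apply: ler_hsum => h _; apply: node_rho_le.
Qed.

Lemma rho_leD P t mu nu : flow P nu ->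
  rho t (fun h d k i => mu h d k i + nu h d k i) <= rho t mu + mass P.
Proof.
move=> fl; rewrite -(flow_mass t fl) /rho -hsumD; case: fl => p0 _ _.
by apply: ler_hsum => h _; apply: node_rho_leD.
Qed.

Lemma rho_cat s t mu : rho (s + t) mu = hsum s (fun h => rho t (fun h' => mu (h ++ h'))).
Proof. exact: hsum_cat. Qed.

Definition behaviour2 (f : seq D -> D -> J -> R) :=
  (forall h d j, 0 <= f h d j) /\ (forall h d, \sum_j f h d j = 1).

Lemma rho_le_pay f t mu : behaviour2 f -> rho t mu <= pay f t mu.
Proof.
move=> [f0 f1]; apply: ler_hsum => h _; apply: ler_sum => d _.
rewrite -[leLHS]mul1r -(f1 h d) mulr_suml; apply: ler_sum => j _.
by apply: ler_wpM2l => //; apply: fmin_le.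
Qed.

Lemma pay_ge0 P f t mu : behaviour2 f -> flow P mu -> 0 <= pay f t mu.
Proof. by move=> fB fl; apply: le_trans (rho_le_pay _ _ fB); apply: rho_ge0 fl. Qed.

Lemma pay_le P f t mu : behaviour2 f -> flow P mu -> pay f t mu <= mass P.
Proof.
move=> [f0 f1] fl; rewrite -(flow_mass t fl); case: fl => p0 _ _.
apply: ler_hsum => h _; apply: ler_sum => d _.
rewrite -[leRHS]mul1r -(f1 h d) mulr_suml; apply: ler_sum => j _.
by apply: ler_wpM2l => //; apply: cost_le.
Qed.

(* The minimum over player 2's replies decouples over nodes, so regret matching
   run at every node of the block yields a single good reply. *)
Lemma block_reply P n l w e : mass P <= 1 -> 0 < e ->
  (forall mu, flow P mu -> \sum_(s < n) rho (l + s) mu <= w) ->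
  exists2 f, behaviour2 f & forall mu, flow P mu -> \sum_(s < n) pay f (l + s) mu <= w + e.
Proof.
move=> P1 e0 Hw; apply: contrapT => nf.
pose E (F : seq D * D -> R) := \sum_(s < n) hsum (l + s) (fun h => \sum_d F (h, d)).
pose A (a : seq D * D -> J -> R) := exists2 mu, flow P mu & a = fun x => cost (mu x.1) x.2.
have ED F G : E (fun x => F x + G x) = E F + E G.
  rewrite /E -big_split /=; apply: eq_bigr => s _; rewrite -hsumD; apply: eq_hsum => h _.
  by rewrite big_split.
have EZ c F : E (fun x => c * F x) = c * E F.
  rewrite /E mulr_sumr; apply: eq_bigr => s _; rewrite -hsumZ; apply: eq_hsum => h _.
  by rewrite mulr_sumr.
have Ele F G : (forall x, F x <= G x) -> E F <= E G.
  by move=> FG; apply: ler_sum => s _; apply: ler_hsum => h _; apply: ler_sum.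
have A01 a : A a -> forall x j, 0 <= a x j <= 1.
  move=> [mu fl ->] [h d] j /=; have [p0 _ _] := fl; rewrite cost_ge0 //=.
  apply: le_trans (cost_le _ _ _) _ => //; apply: le_trans P1.
  apply: le_trans (flow_mass_le h fl); rewrite /mass (bigD1 d) //= lerDl.
  by apply: sumr_ge0 => d' _; apply: sumr_ge0 => k _; apply: sumr_ge0.
have Aconv a b c : A a -> A b -> 0 <= c <= 1 -> A (fun x j => c * a x j + (1 - c) * b x j).
  move=> [mu fm ->] [nu fn ->] /andP[c0 c1].
  exists (fun h d k i => c * mu h d k i + (1 - c) * nu h d k i).
    apply: flow_ext (flowD (flowZ c0 fm) (flowZ _ fn)); last by rewrite subr_ge0.
    by move=> d k; ring.
  by apply/funext => x; apply/funext => j; rewrite costD !costZ.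
have Aresp f : mixed f -> exists2 a, A a & w + e <= E (fun x => \sum_j f x j * a x j).
  move=> fB.
  have [mu fl gt] : exists2 mu, flow P mu & w + e < \sum_(s < n) pay (fun h d => f (h, d)) (l + s) mu.
    apply: contrapT => nm; apply: nf; exists (fun h d => f (h, d)).
      by case: fB => f0 f1; split.
    by move=> mu fl; rewrite leNgt; apply/negP => lt; apply: nm; exists mu.
  by exists (fun x => cost (mu x.1) x.2); [exists mu | exact: ltW].
have e2 : 0 < e / 2 by rewrite divr_gt0.
have [a [mu fl ->]] := regret_minimax j0 ED EZ Ele A01 Aconv Aresp e2.
have := Hw _ fl; rewrite /E /rho /node_rho /=; lra.
Qed.

Definition upper P w := exists2 n, (0 < n)%N &
  forall l mu, flow P mu -> \sum_(s < n) rho (l + s) mu <= n%:R * w.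

Definition vstar P := inf [set w | upper P w].

Lemma upper_has_inf P : (forall d k, 0 <= P d k) -> mass P = 1 ->
  has_inf [set w | upper P w].
Proof.
move=> P0 P1; split.
  exists 1; exists 1%N => // l mu fl; rewrite big_ord1 mulr1 -P1; exact: rho_le fl.
exists 0 => w [n n0 H]; have [mu fl] := flow_ex P0.
have := H 0%N mu fl; have : 0 <= \sum_(s < n) rho (0 + s) mu.
  by apply: sumr_ge0 => s _; apply: rho_ge0 fl.
move=> /le_trans h /h; rewrite pmulr_rge0 // ltr0n //.
Qed.

Lemma vstar_ge0 P : (forall d k, 0 <= P d k) -> mass P = 1 -> 0 <= vstar P.
Proof.
move=> P0 P1; have [ne _] := upper_has_inf P0 P1.
apply: lb_le_inf => // w [n n0 H]; have [mu fl] := flow_ex P0.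
have := H 0%N mu fl; have : 0 <= \sum_(s < n) rho (0 + s) mu.
  by apply: sumr_ge0 => s _; apply: rho_ge0 fl.
move=> /le_trans h /h; rewrite pmulr_rge0 // ltr0n //.
Qed.

Lemma player2_blocks P e : (forall d k, 0 <= P d k) -> mass P = 1 -> 0 < e ->
  exists f n, [/\ behaviour2 f, (0 < n)%N & forall mu b, flow P mu ->
    \sum_(s < n) pay f (b * n + s) mu <= n%:R * (vstar P + e)].
Proof.
move=> P0 P1 e0; have hi := upper_has_inf P0 P1.
have e2 : 0 < e / 2 by rewrite divr_gt0.
have [w [n n0 Hw] wlt] := inf_adherent e2 hi; rewrite -/(vstar P) in wlt.
have n0' : 0 < n%:R :> R by rewrite ltr0n.
have H b : exists f, behaviour2 f /\ forall mu, flow P mu ->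
    \sum_(s < n) pay f (b * n + s) mu <= n%:R * w + n%:R * (e / 2).
  have P1' : mass P <= 1 by rewrite P1.
  have ne : 0 < n%:R * (e / 2) by rewrite mulr_gt0.
  by have [f fB fH] := block_reply P1' ne (Hw (b * n)%N); exists f.
have [F FH] := choice H.
exists (fun h => F (size h %/ n)%N h), n; split=> //.
  by split=> h; case: (FH (size h %/ n)%N) => [[f0 f1] _].
move=> mu b fl; have [_ /(_ mu fl) bl] := FH b.
have -> : \sum_(s < n) pay (fun h => F (size h %/ n)%N h) (b * n + s) mu =
    \sum_(s < n) pay (F b) (b * n + s) mu.
  apply: eq_bigr => s _; apply: eq_hsum => h ->.
  by rewrite divnMDl // divn_small // addn0.
apply: (le_trans bl); rewrite -mulrDr ler_pM2l //; lra.
Qed.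

Definition weighted_rho T (th : nat -> R) mu := \sum_(t < T) th t * rho t mu.
Definition prob T (th : nat -> R) := (forall t, 0 <= th t) /\ \sum_(t < T) th t = 1.

Lemma shift_sum (u : nat -> R) n l t : (forall s, 0 <= u s <= 1) ->
  \sum_(m < n) u (l + m)%N - t%:R <= \sum_(m < n) u (l + m + t)%N.
Proof.
move=> u01; elim: t => [|t IH].
  by rewrite subr0; apply: ler_sum => m _; rewrite addn0.
have : \sum_(m < n.+1) u (l + m + t)%N = \sum_(m < n.+1) u (l + m + t)%N by [].
rewrite {1}big_ord_recl big_ord_recr /= addn0.
have -> : \sum_(m < n) u (l + bump 0 m + t)%N = \sum_(m < n) u (l + m + t.+1)%N.
  by apply: eq_bigr => m _; rewrite /bump add1n addnS addSn addnS.
have /andP[_ a] := u01 (l + t)%N; have /andP[b _] := u01 (l + n + t)%N.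
move: IH; rewrite -(natr1 t); lra.
Qed.

Lemma player1_shift P w T th e : (forall d k, 0 <= P d k) -> mass P = 1 ->
  w < vstar P -> prob T th -> 0 < e ->
  exists (m : nat) mu, flow P mu /\ w - e <= \sum_(t < T) th t * rho (m + t) mu.
Proof.
move=> P0 P1 wv [th0 th1] e0; apply: contrapT => nex.
have [n n0 nT] : exists2 n : nat, (0 < n)%N & T%:R <= n%:R * e.
  exists (Num.bound (T%:R / e)).+1 => //; rewrite -ler_pdivrMr //.
  have /archi_boundP/ltW bnd : 0 <= T%:R / e by rewrite divr_ge0 // ltW.
  by apply: (le_trans bnd); rewrite ler_nat.
have n0' : 0 < n%:R :> R by rewrite ltr0n.
have : ~ upper P w.
  move=> up; move: wv; rewrite ltNge => /negP; apply; apply: ge_inf => //.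
  by case: (upper_has_inf P0 P1).
apply; exists n => // l mu fl; rewrite leNgt; apply/negP => gt.
have u01 s : 0 <= rho s mu <= 1 by rewrite (rho_ge0 s fl) -P1 (rho_le s fl).
have lo : \sum_(m < n) \sum_(t < T) th t * rho (l + m + t) mu <= \sum_(m < n) (w - e).
  apply: ler_sum => m _; rewrite leNgt; apply/negP => lt; apply: nex.
  by exists (l + m)%N, mu; split=> //; apply: ltW.
have hi : \sum_(m < n) \sum_(t < T) th t * rho (l + m + t) mu >=
    \sum_(t < T) th t * (\sum_(s < n) rho (l + s) mu - T%:R).
  rewrite exchange_big /=; apply: ler_sum => t _; rewrite -mulr_sumr ler_wpM2l //.
  apply: le_trans (shift_sum n l t u01); rewrite lerD2l lerN2 ler_nat; exact: ltnW.
move: hi lo; rewrite -mulr_suml th1 mul1r sumr_const card_ord -[_ *+ n]mulr_natl.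
nra.
Qed.

Lemma weighted_rho_ge0 P T th mu : prob T th -> flow P mu -> 0 <= weighted_rho T th mu.
Proof.
by move=> [th0 _] fl; apply: sumr_ge0 => t _; rewrite mulr_ge0 // (rho_ge0 t fl).
Qed.

Lemma weighted_rho_le P T th mu : prob T th -> flow P mu -> weighted_rho T th mu <= mass P.
Proof.
move=> [th0 th1] fl; rewrite -[leRHS]mul1r -th1 mulr_suml; apply: ler_sum => t _.
by apply: ler_wpM2l => //; apply: rho_le fl.
Qed.

Lemma weighted_rhoZ T th c mu : 0 <= c ->
  weighted_rho T th (fun h d k i => c * mu h d k i) = c * weighted_rho T th mu.
Proof.
by move=> c0; rewrite /weighted_rho mulr_sumr; apply: eq_bigr => t _; rewrite rhoZ // mulrCA.
Qed.

Lemma weighted_rho_leD P T th mu nu : prob T th -> flow P nu ->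
  weighted_rho T th (fun h d k i => mu h d k i + nu h d k i) <= weighted_rho T th mu + mass P.
Proof.
move=> [th0 th1] fl; rewrite -[mass P]mul1r -th1 mulr_suml -big_split.
by apply: ler_sum => t _ /=; rewrite -mulrDr ler_wpM2l // rho_leD.
Qed.

Lemma weighted_rho_geD P P' T th mu nu : prob T th -> flow P mu -> flow P' nu ->
  weighted_rho T th mu <= weighted_rho T th (fun h d k i => mu h d k i + nu h d k i).
Proof.
move=> [th0 th1] fm fn; apply: ler_sum => t _; rewrite ler_wpM2l //.
apply: le_trans (rhoD t mu nu); rewrite lerDl; exact: rho_ge0 fn.
Qed.

Definition best_rho T th P := sup [set y | exists2 mu, flow P mu & y = weighted_rho T th mu].

Lemma best_rho_has_sup T th P : prob T th -> (forall d k, 0 <= P d k) ->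
  has_sup [set y | exists2 mu, flow P mu & y = weighted_rho T th mu].
Proof.
move=> pr P0; split; first by have [mu fl] := flow_ex P0; exists (weighted_rho T th mu), mu.
by exists (mass P) => y [mu fl ->]; apply: weighted_rho_le.
Qed.

Lemma le_best_rho T th P mu : prob T th -> (forall d k, 0 <= P d k) -> flow P mu ->
  weighted_rho T th mu <= best_rho T th P.
Proof. by move=> pr P0 fl; apply: (sup_upper_bound (best_rho_has_sup pr P0)); exists mu. Qed.

Lemma best_rho_ge0 T th P : prob T th -> (forall d k, 0 <= P d k) -> 0 <= best_rho T th P.
Proof.
move=> pr P0; have [mu fl] := flow_ex P0.
by apply: le_trans (le_best_rho pr P0 fl); apply: weighted_rho_ge0 fl.
Qed.

Lemma best_rho_le T th P : prob T th -> (forall d k, 0 <= P d k) -> best_rho T th P <= mass P.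
Proof.
move=> pr P0; apply: ge_sup; first by case: (best_rho_has_sup pr P0).
by move=> y [mu fl ->]; apply: weighted_rho_le.
Qed.

Definition grid_pt L (a : {ffun D * K -> 'I_L.+1}) d k : R := (a (d, k))%:R / L%:R.

(* There are finitely many codes: this is the total boundedness of the value functions. *)
Definition value_code L T th : {ffun {ffun D * K -> 'I_L.+1} -> 'I_(L * #|{: D * K}|).+1} :=
  [ffun a => inord (Num.truncn (L%:R * best_rho T th (grid_pt a)))].

Lemma mass_pair P c : (forall d k, P d k <= c) -> mass P <= #|{: D * K}|%:R * c.
Proof.
move=> Pc; rewrite /mass pair_big /= mulr_natl -sumr_const; apply: ler_sum => -[d k] _; exact: Pc.
Qed.

Lemma value_code_close L T th T' th' : (0 < L)%N -> prob T th -> prob T' th' ->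
  value_code L T th = value_code L T' th' -> forall P mu, (forall d k, 0 <= P d k) -> mass P = 1 ->
  flow P mu -> exists2 nu, flow P nu &
  weighted_rho T th mu <= weighted_rho T' th' nu + (#|{: D * K}| + 2)%:R / L%:R.
Proof.
move=> L0 pr pr' cc P mu P0 P1 fl.
have L0' : 0 < L%:R :> R by rewrite ltr0n.
have Ple d k : P d k <= 1.
  rewrite -P1 /mass (bigD1 d) //= (bigD1 k) //= -addrA lerDl addr_ge0 // sumr_ge0 // => *.
  exact: sumr_ge0.
have LP d k : 0 <= L%:R * P d k by rewrite mulr_ge0.
pose a : {ffun D * K -> 'I_L.+1} := [ffun x => inord (Num.truncn (L%:R * P x.1 x.2))].
have aE d k : (a (d, k) : nat) = Num.truncn (L%:R * P d k).
  rewrite ffunE inordK //= ltnS truncn_le_nat -natr1.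
  apply: (@le_lt_trans _ _ L%:R); first by rewrite ler_piMr.
  by rewrite ltrDl.
pose P' := grid_pt a.
have P'0 d k : 0 <= P' d k by rewrite divr_ge0.
have P'P d k : P' d k <= P d k.
  by rewrite /P' /grid_pt aE ler_pdivrMr // [leRHS]mulrC truncn_le.
have PP' d k : P d k - P' d k <= L%:R^-1.
  rewrite /P' /grid_pt aE -(ler_pM2l L0') mulrBr mulrCA !divff ?gt_eqF // mulr1.
  by rewrite lerBlDl natr1; apply/ltW/truncnS_gt.
have [nu fn nm] := flow_restrict fl (fun d k => introT andP (conj (P'0 d k) (P'P d k))).
have fB := flowB fl fn nm.
have v1 : weighted_rho T th mu <= best_rho T th P' + #|{: D * K}|%:R / L%:R.
  have muE : mu = fun h d k i => nu h d k i + (mu h d k i - nu h d k i).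
    by do 4 apply/funext => ?; rewrite addrC subrK.
  rewrite [in leLHS]muE; apply: le_trans (weighted_rho_leD nu pr fB) _.
  apply: lerD; first exact: le_best_rho.
  exact: mass_pair.
have v2 : L%:R * best_rho T th P' <= L%:R * best_rho T' th' P' + 1.
  have bd T1 th1 : prob T1 th1 -> (Num.truncn (L%:R * best_rho T1 th1 P') < (L * #|{: D * K}|).+1)%N.
    move=> pr1; rewrite ltnS truncn_le_nat -natr1 natrM.
    apply: (@le_lt_trans _ _ (L%:R * #|{: D * K}|%:R)); last by rewrite ltrDl.
    rewrite ler_pM2l //; apply: le_trans (best_rho_le pr1 P'0) _.
    by rewrite -[leRHS]mulr1; apply: mass_pair => d k; apply: le_trans (P'P d k) _.
  have := congr1 (fun c : {ffun _ -> _} => nat_of_ord (c a)) cc.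
  rewrite /= !ffunE !inordK ?bd // -/P' => e.
  have /truncn_itv/andP[h1 _] : 0 <= L%:R * best_rho T' th' P' by rewrite mulr_ge0 // best_rho_ge0.
  have /truncn_itv/andP[_ h2] : 0 <= L%:R * best_rho T th P' by rewrite mulr_ge0 // best_rho_ge0.
  by apply: (le_trans (ltW h2)); rewrite -natr1 e lerD2r.
have Li : 0 < L%:R^-1 :> R by rewrite invr_gt0.
have [_ [nu' fn' ->] lt] := sup_adherent Li (best_rho_has_sup pr' P'0).
rewrite -/(best_rho T' th' P') in lt.
exists (fun h d k i => nu' h d k i + (mu h d k i - nu h d k i)).
  by apply: flow_ext (flowD fn' fB) => d k; rewrite addrC subrK.
have v3 := weighted_rho_geD pr' fn' fB.
have v4 : best_rho T th P' <= best_rho T' th' P' + L%:R^-1.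
  by rewrite -(ler_pM2l L0') mulrDr divff ?gt_eqF.
rewrite natrD mulrDl; lra.
Qed.

Lemma value_code_close_mass L T th T' th' : (0 < L)%N -> prob T th -> prob T' th' ->
  value_code L T th = value_code L T' th' -> forall P mu, (forall d k, 0 <= P d k) ->
  flow P mu -> exists2 nu, flow P nu &
  weighted_rho T th mu <= weighted_rho T' th' nu + (#|{: D * K}| + 2)%:R / L%:R * mass P.
Proof.
move=> L0 pr pr' cc P mu P0 fl; have [m0|m0] := eqVneq (mass P) 0.
  exists mu => //; rewrite m0 mulr0 addr0; apply: (@le_trans _ _ 0); last exact: weighted_rho_ge0 fl.
  by rewrite -m0; apply: weighted_rho_le.
have mp : 0 < mass P by rewrite lt_def m0 mass_ge0.
have ip : 0 <= (mass P)^-1 by rewrite invr_ge0 ltW.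
have [||nu fn le] := value_code_close L0 pr pr' cc _ _ (flowZ ip fl).
- by move=> d k; rewrite mulr_ge0.
- rewrite /mass; under eq_bigr => d _ do rewrite -mulr_sumr.
  by rewrite -mulr_sumr mulVf.
exists (fun h d k i => mass P * nu h d k i).
  by apply: flow_ext (flowZ (ltW mp) fn) => d k; rewrite mulrA divff // mul1r.
move: le; rewrite (weighted_rhoZ _ _ _ ip) (weighted_rhoZ _ _ _ (ltW mp)) ler_pdivrMl // mulrDr.
by rewrite [X in _ <= _ + X -> _]mulrC.
Qed.

Lemma player1_uniform_shift P w e : (forall d k, 0 <= P d k) -> mass P = 1 ->
  w < vstar P -> 0 < e ->
  exists M, forall T th, prob T th -> exists (m : nat) mu,
    [/\ (m <= M)%N, flow P mu & w - e <= \sum_(t < T) th t * rho (m + t) mu].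
Proof.
move=> P0 P1 wv e0; have e2 : 0 < e / 2 by rewrite divr_gt0.
have [L L0 Le] : exists2 L : nat, (0 < L)%N & (#|{: D * K}| + 2)%:R / L%:R <= e / 2.
  exists (Num.bound ((#|{: D * K}| + 2)%:R / (e / 2))).+1 => //.
  rewrite ler_pdivrMr ?ltr0n // [leRHS]mulrC -ler_pdivrMr //.
  have /archi_boundP/ltW bnd : 0 <= (#|{: D * K}| + 2)%:R / (e / 2) by rewrite divr_ge0 // ltW.
  by apply: (le_trans bnd); rewrite ler_nat.
pose good c (m : nat) := exists T th mu, [/\ prob T th, value_code L T th = c, flow P mu &
  w - e / 2 <= \sum_(t < T) th t * rho (m + t) mu].
have H c : exists m : nat, (exists m : nat, good c m) -> good c m.
  by have [[m gm]|ng] := pselect (exists m : nat, good c m); [exists m | exists 0%N].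
have [F FH] := choice H.
exists (\max_c F c)%N => T' th' pr'.
have [m1 [mu1 [fl1 le1]]] := player1_shift P0 P1 wv pr' e2.
have [|T [th [mu [pr cc fl le]]]] := FH (value_code L T' th').
  by exists m1, T', th', mu1.
set m := F _ in le; exists m.
have Hn h : exists nu, flow (marg (mu h)) nu /\
    weighted_rho T th (fun h' => mu (h ++ h')) <= weighted_rho T' th' nu + e / 2 * mass (marg (mu h)).
  have [|nu fn len] := value_code_close_mass L0 pr pr' cc _ (flow_sub h fl).
    by apply: marg_ge0; case: fl.
  exists nu; split=> //; apply: (le_trans len); rewrite lerD2l ler_wpM2r //.
  by apply: mass_ge0; apply: marg_ge0; case: fl.
have [nu nuH] := choice Hn.
have nuF h := proj1 (nuH h); have nuL h := proj2 (nuH h).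
exists (fun h => if (size h < m)%N then mu h else nu (take m h) (drop m h)).
split; [exact: leq_bigmax | exact: flow_splice|].
have E1 : \sum_(t < T) th t * rho (m + t) mu = hsum m (fun h => weighted_rho T th (fun h' => mu (h ++ h'))).
  rewrite /weighted_rho hsum_sum; apply: eq_bigr => t _; rewrite hsumZ rho_cat //.
have E2 : \sum_(t < T') th' t * rho (m + t) (fun h => if (size h < m)%N then mu h
    else nu (take m h) (drop m h)) = hsum m (fun h => weighted_rho T' th' (nu h)).
  rewrite /weighted_rho hsum_sum; apply: eq_bigr => t _; rewrite hsumZ rho_cat; congr (_ * _).
  apply: eq_hsum => h hm; apply: eq_hsum => h' _.
  by rewrite size_cat hm ltnNge leq_addr /= -hm take_size_cat // drop_size_cat.
have := ler_hsum (fun h (_ : size h = m) => nuL h).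
rewrite -E1 hsumD -E2 hsumZ (flow_mass m fl) P1; lra.
Qed.

Definition mixture M P (lam : 'I_M.+1 -> R) (mus : 'I_M.+1 -> seq D -> D -> K -> I -> R) :=
  [/\ forall m, 0 <= lam m, \sum_m lam m = 1 &
      forall m, flow (fun d k => lam m * P d k) (mus m)].

Lemma player1_finite P w e : (forall d k, 0 <= P d k) -> mass P = 1 ->
  w < vstar P -> 0 < e ->
  exists M, forall N, exists lam mus, mixture (M := M) P lam mus /\
    forall t : nat, (t <= N)%N -> w - e <= \sum_(m < M.+1) rho (m + t) (mus m).
Proof.
move=> P0 P1 wv e0; have e2 : 0 < e / 2 by rewrite divr_gt0.
have [M MH] := player1_uniform_shift P0 P1 wv e2; exists M => N.
pose E (F : unit -> R) := F tt.
pose A (a : unit -> 'I_N.+1 -> R) := (forall x j, 0 <= a x j <= 1) /\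
  exists lam mus, mixture (M := M) P lam mus /\
    forall t : 'I_N.+1, a tt t <= \sum_(m < M.+1) rho (m + t) (mus m).
have A01 a : A a -> forall x j, 0 <= a x j <= 1 by case.
have Aconv a b c : A a -> A b -> 0 <= c <= 1 -> A (fun x j => c * a x j + (1 - c) * b x j).
  move=> [a01 [la [ma [[la0 la1 fa] aH]]]] [b01 [lb [mb [[lb0 lb1 fb] bH]]]] /andP[c0 c1].
  have c1' : 0 <= 1 - c by rewrite subr_ge0.
  split.
    by move=> x j; have /andP[] := a01 x j; have /andP[] := b01 x j; nra.
  exists (fun m => c * la m + (1 - c) * lb m).
  exists (fun m h d k i => c * ma m h d k i + (1 - c) * mb m h d k i).
  split; first split.
  - by move=> m; rewrite addr_ge0 ?mulr_ge0.
  - by rewrite big_split -!mulr_sumr la1 lb1 /=; ring.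
  - move=> m; apply: flow_ext (flowD (flowZ c0 (fa m)) (flowZ c1' (fb m))).
    by move=> d k; ring.
  move=> t; apply: (@le_trans _ _ (c * (\sum_(m < M.+1) rho (m + t) (ma m)) +
     (1 - c) * (\sum_(m < M.+1) rho (m + t) (mb m)))); first by rewrite lerD ?ler_wpM2l.
  rewrite !mulr_sumr -big_split; apply: ler_sum => m _ /=.
  by rewrite -(rhoZ _ _ c0) -(rhoZ _ _ c1') rhoD.
have Aresp f : mixed f -> exists2 a, A a & w - e / 2 <= E (fun x => \sum_j f x j * a x j).
  move=> [f0 f1].
  have [|m [mu [mM fl le]]] := MH N.+1 (fun t => f tt (inord t)).
    by split=> [t //|]; rewrite -(f1 tt); apply: eq_bigr => t _; rewrite inord_val.
  exists (fun _ t => rho (m + t) mu); last first.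
    apply: (le_trans le); rewrite /E le_eqVlt; apply/orP; left; apply/eqP.
    by apply: eq_bigr => t _; rewrite inord_val.
  split; first by move=> _ t; rewrite (rho_ge0 _ fl) -P1 (rho_le _ fl).
  exists (fun o => (o == inord m)%:R), (fun o h d k i => (o == inord m)%:R * mu h d k i).
  split; first split.
  - by move=> o; rewrite ler0n.
  - by rewrite (bigD1 (inord m)) //= eqxx big1 ?addr0 // => o /negbTE ->.
  - by move=> o; apply: flowZ; rewrite ?ler0n.
  move=> t; rewrite (bigD1 (inord m)) //= rhoZ ?ler0n // eqxx mul1r inordK // lerDl.
  by apply: sumr_ge0 => o _; rewrite rhoZ ?ler0n // mulr_ge0 ?ler0n // (rho_ge0 _ fl).
have [a [_ [lam [mus [mx aH]]]] le] := regret_minimax (ord0 : 'I_N.+1)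
  (fun F G => erefl : E (fun x => F x + G x) = E F + E G)
  (fun c F => erefl : E (fun x => c * F x) = c * E F)
  (fun F G (H : forall x, F x <= G x) => H tt) A01 Aconv Aresp e2.
exists lam, mus; split=> // t tN.
have := aH (inord t); rewrite inordK // => h.
have := fmin_le (ord0 : 'I_N.+1) (a tt) (inord t); rewrite /E in le; lra.
Qed.

Lemma rho_pay_ex mu : exists f, behaviour2 f /\ forall t, rho t mu = pay f t mu.
Proof.
have [F FH] := choice (fun hd : seq D * D => fmin_ex j0 (cost (mu hd.1) hd.2)).
exists (fun h d j => (j == F (h, d))%:R); split.
  split=> [h d j|h d]; first by rewrite ler0n.
  by rewrite (bigD1 (F (h, d))) //= eqxx big1 ?addr0 // => j /negbTE ->.
move=> t; apply: eq_hsum => h _; apply: eq_bigr => d _; rewrite (FH (h, d)).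
rewrite (bigD1 (F (h, d))) //= eqxx mul1r big1 ?addr0 // => j /negbTE ->.
by rewrite mul0r.
Qed.

Lemma flow_entry_le P mu h d k i : flow P mu -> mu h d k i <= mass P.
Proof.
move=> fl; apply: le_trans (flow_mass_le h fl); have [p0 _ _] := fl.
rewrite /mass (bigD1 d) //= (bigD1 k) //= /marg (bigD1 i) //= -!addrA lerDl !addr_ge0 //.
- exact: sumr_ge0.
- by apply: sumr_ge0 => *; apply: sumr_ge0.
by apply: sumr_ge0 => *; apply: sumr_ge0 => *; apply: sumr_ge0.
Qed.

Lemma player1_mixture P w e : (forall d k, 0 <= P d k) -> mass P = 1 ->
  w < vstar P -> 0 < e ->
  exists M lam mus, mixture (M := M) P lam mus /\
    forall t : nat, w - e <= \sum_(m < M.+1) rho (m + t) (mus m).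
Proof.
move=> P0 P1 wv e0; have [M MH] := player1_finite P0 P1 wv e0; exists M.
have [lam lamH] := choice MH.
have [mus musH] := choice lamH.
have mx N := proj1 (musH N); have ge N := proj2 (musH N).
have [U UU Uoo] := ultra_eventually.
have lam1 N m : 0 <= lam N m <= 1.
  have [l0 l1 _] := mx N; rewrite l0 -l1 (bigD1 m) //= lerDl.
  by apply: sumr_ge0.
have mass_lam N m : mass (fun d k => lam N m * P d k) = lam N m.
  rewrite /mass; under eq_bigr => d _ do rewrite -mulr_sumr.
  by rewrite -mulr_sumr -/(mass P) P1 mulr1.
have mu1 N m h d k i : 0 <= mus N m h d k i <= 1.
  have [_ _ /(_ m) fl] := mx N; have [-> _ _] := fl; rewrite /=.
  by apply: le_trans (flow_entry_le h d k i fl) _; rewrite mass_lam; case/andP: (lam1 N m).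
have [lamU lamUH] := choice (fun m => ucv_ex UU (fun N => lam1 N m)).
have [muU muUH] := choice (fun x : 'I_M.+1 * seq D * D * K * I =>
  ucv_ex UU (fun N => mu1 N x.1.1.1.1 x.1.1.1.2 x.1.1.2 x.1.2 x.2)).
have muUcv m h d k i : ucv U (fun N => mus N m h d k i) (muU (m, h, d, k, i)).
  exact: muUH (m, h, d, k, i).
exists lamU, (fun m h d k i => muU (m, h, d, k, i)); split; first split.
- by move=> m; apply: (ucv_ge UU Uoo (N := 0) (lamUH m)) => N _; case/andP: (lam1 N m).
- apply: (ucv_unique UU Uoo (ucv_sum UU lamUH)).
  have -> : (fun n => \sum_m lam n m) = fun=> 1.
    by apply/funext => N; case: (mx N).
  exact: ucv_cst.
- move=> m; split=> [h d k i|d k|h d d' k'].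
  + apply: (ucv_ge UU Uoo (N := 0) (muUcv m h d k i)) => N _.
    by case/andP: (mu1 N m h d k i).
  + apply: (ucv_unique UU Uoo (ucv_sum UU (muUcv m [::] d k))).
    have -> : (fun n => \sum_i mus n m [::] d k i) = fun n => P d k * lam n m.
      by apply/funext => N; have [_ _ /(_ m) [_ r _]] := mx N; rewrite mulrC -r.
    by rewrite mulrC; apply: ucvZ.
  apply: (ucv_unique UU Uoo (ucv_sum UU (muUcv m (rcons h d) d' k'))).
  have -> : (fun n => \sum_i mus n m (rcons h d) d' k' i) =
      fun n => \sum_k \sum_i Q k i d' k' * mus n m h d k i.
    apply/funext => N; have [_ _ /(_ m) [_ _ /(_ h d d' k') r]] := mx N.
    move: r; rewrite /marg /nxt => ->; apply: eq_bigr => k _; apply: eq_bigr => i _.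
    by rewrite mulrC.
  rewrite /nxt; under eq_bigr => k _ do under eq_bigr => i _ do rewrite mulrC.
  by apply: ucv_sum => k; apply: ucv_sum => i; apply: ucvZ.
move=> t.
have [f fH] := choice (fun m => rho_pay_ex (fun h d k i => muU (m, h, d, k, i))).
have -> : \sum_(m < M.+1) rho (m + t) (fun h d k i => muU (m, h, d, k, i)) =
    \sum_(m < M.+1) pay (f m) (m + t) (fun h d k i => muU (m, h, d, k, i)).
  by apply: eq_bigr => m _; case: (fH m) => _ ->.
have cv : ucv U (fun N => \sum_(m < M.+1) pay (f m) (m + t) (mus N m))
    (\sum_(m < M.+1) pay (f m) (m + t) (fun h d k i => muU (m, h, d, k, i))).
  apply: ucv_sum => m; apply: ucv_hsum => h; apply: ucv_sum => d; apply: ucv_sum => j.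
  apply: ucvZ; apply: ucv_sum => k; apply: ucv_sum => i.
  by rewrite mulrC; under eq_fun do rewrite mulrC; apply: ucvZ.
apply: (ucv_ge UU Uoo (N := t) cv) => N tN; apply: le_trans (ge N t tN) _.
by apply: ler_sum => m _; apply: rho_le_pay; case: (fH m).
Qed.

Lemma marg_lin (X : finType) (w : X -> R) (mm : X -> D -> K -> I -> R) d k :
  marg (fun d k i => \sum_x w x * mm x d k i) d k = \sum_x w x * marg (mm x) d k.
Proof.
rewrite /marg; under [RHS]eq_bigr => x _ do rewrite mulr_sumr.
exact: exchange_big.
Qed.

Lemma nxt_lin (X : finType) (w : X -> R) (mm : X -> D -> K -> I -> R) d d' k' :
  nxt (fun d k i => \sum_x w x * mm x d k i) d d' k' = \sum_x w x * nxt (mm x) d d' k'.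
Proof.
rewrite /nxt; under eq_bigr => k _ do under eq_bigr => i _ do rewrite mulr_suml.
under eq_bigr => k _ do rewrite exchange_big /=.
rewrite exchange_big /=; apply: eq_bigr => x _; rewrite mulr_sumr; apply: eq_bigr => k _.
by rewrite mulr_sumr; apply: eq_bigr => i _; rewrite mulrA.
Qed.

Lemma cost_lin (X : finType) (w : X -> R) (mm : X -> D -> K -> I -> R) d j :
  cost (fun d k i => \sum_x w x * mm x d k i) d j = \sum_x w x * cost (mm x) d j.
Proof.
rewrite /cost; under eq_bigr => k _ do under eq_bigr => i _ do rewrite mulr_suml.
under eq_bigr => k _ do rewrite exchange_big /=.
rewrite exchange_big /=; apply: eq_bigr => x _; rewrite mulr_sumr; apply: eq_bigr => k _.
by rewrite mulr_sumr; apply: eq_bigr => i _; rewrite mulrA.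
Qed.

Lemma pay_lin (X : finType) (w : X -> R) (mm : X -> seq D -> D -> K -> I -> R) f t :
  pay f t (fun h d k i => \sum_x w x * mm x h d k i) = \sum_x w x * pay f t (mm x).
Proof.
rewrite /pay; under [RHS]eq_bigr => x _ do rewrite -hsumZ.
rewrite -hsum_sum; apply: eq_hsum => h _.
under [RHS]eq_bigr => x _ do rewrite mulr_sumr.
rewrite [RHS]exchange_big /=; apply: eq_bigr => d _.
under [RHS]eq_bigr => x _ do rewrite mulr_sumr.
rewrite [RHS]exchange_big /=; apply: eq_bigr => j _.
by rewrite cost_lin mulr_sumr; apply: eq_bigr => x _; rewrite mulrCA.
Qed.

Lemma flow_lin (X : finType) (w : X -> R) Ps (mm : X -> seq D -> D -> K -> I -> R) :
  (forall x, 0 <= w x) -> (forall x, flow (Ps x) (mm x)) ->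
  flow (fun d k => \sum_x w x * Ps x d k) (fun h d k i => \sum_x w x * mm x h d k i).
Proof.
move=> w0 fl; split=> [h d k i|d k|h d d' k'].
- by apply: sumr_ge0 => x _; rewrite mulr_ge0 //; case: (fl x).
- by rewrite marg_lin; apply: eq_bigr => x _; case: (fl x) => _ -> _.
by rewrite marg_lin nxt_lin; apply: eq_bigr => x _; case: (fl x) => _ _ ->.
Qed.

Lemma flow_sum M P lam mus : mixture (M := M) P lam mus ->
  flow P (fun h d k i => \sum_m mus m h d k i).
Proof.
move=> [l0 l1 fl]; have := flow_lin (fun=> ler01) fl.
have <- : (fun h d k i => \sum_m mus m h d k i) = fun h d k i => \sum_m 1 * mus m h d k i.
  by do 4 apply/funext => ?; apply: eq_bigr => m _; rewrite mul1r.
apply: flow_ext => d k; under eq_bigr do rewrite mul1r.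
by rewrite -mulr_suml l1 mul1r.
Qed.

Lemma rho_sum M t (mus : 'I_M.+1 -> seq D -> D -> K -> I -> R) :
  \sum_m rho t (mus m) <= rho t (fun h d k i => \sum_m mus m h d k i).
Proof.
rewrite /rho -hsum_sum; apply: ler_hsum => h _; rewrite /node_rho exchange_big /=.
apply: ler_sum => d _; apply: le_fmin => j.
have -> : cost (fun d k i => \sum_m mus m h d k i) d j = \sum_m cost (mus m h) d j.
  rewrite /cost; under eq_bigr => k _ do under eq_bigr => i _ do rewrite mulr_suml.
  under eq_bigr => k _ do rewrite exchange_big /=.
  by rewrite exchange_big.
by apply: ler_sum => m _; apply: fmin_le.
Qed.

(* Playing the [m]-th component with probability [lam m] plays it [m] stages too
   early; the resulting error is controlled by the variation of the weights. *)
Lemma player1_guarantee P e : (forall d k, 0 <= P d k) -> mass P = 1 -> 0 < e ->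
  exists M mu, flow P mu /\ forall th B T, (forall t, 0 <= th t) ->
    (forall N, \sum_(t < N) `|th t.+1 - th t| <= B) ->
    (vstar P - e) * \sum_(t < T) th t - M%:R * B <= \sum_(s < M + T) th s * rho s mu.
Proof.
move=> P0 P1 e0; have e2 : 0 < e / 2 by rewrite divr_gt0.
have wv : vstar P - e / 2 < vstar P by lra.
have [M [lam [mus [mx ge]]]] := player1_mixture P0 P1 wv e2.
exists M, (fun h d k i => \sum_m mus m h d k i); split; first exact: flow_sum mx.
move=> th B T th0 thB; have [l0 l1 fl] := mx.
have rl m t : 0 <= rho t (mus m) <= lam m.
  rewrite (rho_ge0 t (fl m)) (le_trans (rho_le t (fl m))) // /mass.
  under eq_bigr => d _ do rewrite -mulr_sumr.
  by rewrite -mulr_sumr -/(mass P) P1 mulr1.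
have B0 : 0 <= B by have := thB 0%N; rewrite big_ord0.
apply: (@le_trans _ _ (\sum_(m < M.+1) \sum_(s < M + T) th s * rho s (mus m))); last first.
  rewrite exchange_big /=; apply: ler_sum => s _; rewrite -mulr_sumr ler_wpM2l //.
  exact: rho_sum.
apply: (@le_trans _ _ (\sum_(m < M.+1)
   (\sum_(t < T) th t * rho (m + t) (mus m) - lam m * (M%:R * B)))).
  rewrite sumrB -mulr_suml l1 mul1r lerD2r exchange_big /= mulr_sumr.
  apply: ler_sum => t _; rewrite -mulr_sumr mulrC ler_wpM2l //.
  by have := ge t; lra.
apply: ler_sum => m _.
apply: (@le_trans _ _ (\sum_(t < T) th (m + t)%N * rho (m + t) (mus m))); last first.
  apply: (@le_trans _ _ (\sum_(s < m + T) th s * rho s (mus m))).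
    rewrite (sum_ord_add (fun s => th s * rho s (mus m))) lerDr sumr_ge0 // => t _.
    by rewrite mulr_ge0 //; case/andP: (rl m t).
  apply: (sum_ord_le (F := fun s => th s * rho s (mus m))).
    by rewrite leq_add2r -ltnS.
  by move=> t; rewrite mulr_ge0 //; case/andP: (rl m t).
rewrite lerBlDl -lerBlDr -sumrB.
apply: (@le_trans _ _ (\sum_(t < T) lam m * `|th (m + t)%N - th t|)).
  apply: ler_sum => t _; have /andP[r0 r1] := rl m (m + t)%N.
  rewrite -mulrBl distrC; apply: (@le_trans _ _ (`|th t - th (m + t)%N| * rho (m + t) (mus m))).
    by rewrite ler_wpM2r // ler_norm.
  by rewrite mulrC ler_wpM2r.
rewrite -mulr_sumr ler_wpM2l //; apply: le_trans (tv_shift thB m T) _.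
by rewrite ler_wpM2r // ler_nat -ltnS.
Qed.

Lemma player2_guarantee P e : (forall d k, 0 <= P d k) -> mass P = 1 -> 0 < e ->
  exists C f, [/\ 0 <= C, behaviour2 f & forall mu th B T, flow P mu -> (forall t, 0 <= th t) ->
    (forall N, \sum_(t < N) `|th t.+1 - th t| <= B) ->
    (forall N, \sum_(t < N) th t <= 1) ->
    \sum_(s < T) th s * pay f s mu <= vstar P + e + C * B].
Proof.
move=> P0 P1 e0; have [f [n [fB n0 fH]]] := player2_blocks P0 P1 e0.
have c0 : 0 <= vstar P + e by apply: addr_ge0; [exact: vstar_ge0 | exact: ltW].
exists ((1 + (vstar P + e)) * n%:R), f; split=> //.
  by rewrite mulr_ge0 // addr_ge0.
move=> mu th B T fl th0 thB th1.
have p01 t : 0 <= pay f t mu <= 1 by rewrite (pay_ge0 t fB fl) -P1 (pay_le t fB fl).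
apply: (@le_trans _ _ (\sum_(s < T * n) th s * pay f s mu)).
  apply: (sum_ord_le (F := fun s => th s * pay f s mu)); first by rewrite leq_pmulr.
  by move=> t; rewrite mulr_ge0 //; case/andP: (p01 t).
apply: (le_trans (block_sum th0 thB T c0 p01 (fun b => fH mu b fl))).
by rewrite lerD2r ler_piMr.
Qed.

End Flows.

(** * From the game to flows *)

Section InformedGame.
Local Open Scope ring_scope.
Variables (R : realType) (K I J C D : finType) (i0 : I) (j0 : J).
Variable q : K -> I -> J -> K * C * D -> R.
Variable g : K -> I -> J -> R.
Variables (ktil : C -> K) (dtil : C -> D).

Definition pt c : K * C * D := (ktil c, c, dtil c).

Hypothesis q_ge0 : forall k i j y, 0 <= q k i j y.
Hypothesis q_sum : forall k i j, \sum_y q k i j y = 1.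
Hypothesis q_E : forall k i j y, y != pt y.1.2 -> q k i j y = 0.

Definition fib (nu : C -> R) d k := \sum_c (dtil c == d)%:R * (ktil c == k)%:R * nu c.

Hypothesis q_fib : forall k i j j' d' k',
  fib (fun c => q k i j (pt c)) d' k' = fib (fun c => q k i j' (pt c)) d' k'.

Definition Qfib k i d' k' := fib (fun c => q k i j0 (pt c)) d' k'.

Lemma sum_delta (T : finType) (a : T) (F : T -> R) : \sum_x (a == x)%:R * F x = F a.
Proof.
rewrite (bigD1 a) //= eqxx mul1r big1 ?addr0 // => x; rewrite eq_sym => /negbTE ->.
by rewrite mul0r.
Qed.

Lemma fib_sum nu (F : D -> K -> R) :
  \sum_c nu c * F (dtil c) (ktil c) = \sum_d \sum_k fib nu d k * F d k.
Proof.
rewrite /fib; under [RHS]eq_bigr => d _ do under eq_bigr => k _ do rewrite mulr_suml.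
under [RHS]eq_bigr => d _ do rewrite exchange_big /=.
rewrite [RHS]exchange_big /=; apply: eq_bigr => c _.
rewrite -(sum_delta (dtil c) (fun d => nu c * F d (ktil c))); apply: eq_bigr => d _.
rewrite -(sum_delta (ktil c) (fun k => nu c * F d k)) mulr_sumr; apply: eq_bigr => k _.
by rewrite !mulrA.
Qed.

Lemma fib_ge0 nu : (forall c, 0 <= nu c) -> forall d k, 0 <= fib nu d k.
Proof. by move=> nu0 d k; apply: sumr_ge0 => c _; rewrite !mulr_ge0. Qed.

Lemma mass_fib nu : mass (fib nu) = \sum_c nu c.
Proof.
transitivity (\sum_c nu c * 1); last by apply: eq_bigr => c _; rewrite mulr1.
by rewrite (fib_sum nu (fun _ _ => 1)) /mass; do 2 apply: eq_bigr => ? _; rewrite mulr1.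
Qed.

Lemma fib_lin (X : finType) (w : X -> R) (nu : X -> C -> R) d k :
  fib (fun c => \sum_x w x * nu x c) d k = \sum_x w x * fib (nu x) d k.
Proof.
rewrite /fib; under eq_bigr => c _ do rewrite mulr_sumr.
rewrite exchange_big /=; apply: eq_bigr => x _ /=; rewrite mulr_sumr.
by apply: eq_bigr => c _; ring.
Qed.

Lemma sum_pt (p : K * C * D -> R) G : (forall y, y != pt y.1.2 -> p y = 0) ->
  \sum_y p y * G y = \sum_c p (pt c) * G (pt c).
Proof.
move=> pE; rewrite (bigID (fun y => y == pt y.1.2)) /= addrC big1 ?add0r; last first.
  by move=> y /pE ->; rewrite mul0r.
rewrite (reindex_onto pt (fun y => y.1.2)) /=; last by move=> y /eqP <-.
by apply: eq_bigl => c; rewrite /= !eqxx.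
Qed.

Lemma Qfib_ge0 k i d k' : 0 <= Qfib k i d k'.
Proof. exact: fib_ge0. Qed.

Lemma Qfib_sum k i : \sum_d \sum_k' Qfib k i d k' = 1.
Proof.
rewrite -[LHS]/(mass (fib (fun c => q k i j0 (pt c)))) mass_fib -(q_sum k i j0).
under [RHS]eq_bigr => y _ do rewrite -[q _ _ _ _]mulr1.
by rewrite (sum_pt (fun=> 1)) //; last exact: q_E; apply: eq_bigr => c _; rewrite mulr1.
Qed.

Fixpoint cond_payoff (sigma : seq (C * I) -> C -> I -> R) (tau : seq (D * J) -> D -> J -> R)
    (n : nat) (x : K * C * D) h1 h2 : R :=
  \sum_i \sum_j sigma h1 x.1.2 i * tau h2 x.2 j *
    match n with
    | O => g x.1.1 i j
    | S m => \sum_y q x.1.1 i j y *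
        cond_payoff sigma tau m y (rcons h1 (x.1.2, i)) (rcons h2 (x.2, j))
    end.

Lemma cond_payoff_shift sigma tau n x h1 h2 : cond_payoff sigma tau n x h1 h2 =
  cond_payoff (fun h => sigma (h1 ++ h)) (fun h => tau (h2 ++ h)) n x [::] [::].
Proof.
elim: n sigma tau x h1 h2 => [|n IH] sigma tau x h1 h2 /=; rewrite !cats0 //.
do 2 (apply: eq_bigr => ? _); congr (_ * _); apply: eq_bigr => y _; congr (_ * _).
rewrite IH [in RHS]IH; congr cond_payoff; apply/funext => h; by rewrite cat_rcons.
Qed.

Lemma cond_payoffS sigma tau n c : cond_payoff sigma tau n.+1 (pt c) [::] [::] =
  \sum_i \sum_j sigma [::] c i * tau [::] (dtil c) j * \sum_c' q (ktil c) i j (pt c') *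
    cond_payoff (fun h => sigma ((c, i) :: h)) (fun h => tau ((dtil c, j) :: h)) n (pt c') [::] [::].
Proof.
rewrite /=; do 2 (apply: eq_bigr => ? _); congr (_ * _).
rewrite sum_pt; last exact: q_E.
by apply: eq_bigr => c' _; rewrite cond_payoff_shift.
Qed.

Definition sigma_of (x : seq D -> D -> K -> I -> R) (h : seq (C * I)) c i :=
  x (map (fun ci => dtil ci.1) h) (dtil c) (ktil c) i.

Definition tau_of (f : seq D -> D -> J -> R) (h : seq (D * J)) d j := f (map fst h) d j.

Lemma sigma_of_guarantee n x tau nu : behaviour1 x -> (forall c, 0 <= nu c) ->
  (forall h d j, 0 <= tau h d j) -> (forall h d, \sum_j tau h d j = 1) ->
  rho j0 g n (flow_of Qfib x (fib nu)) <= \sum_c nu c * cond_payoff (sigma_of x) tau n (pt c) [::] [::].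
Proof.
elim: n x tau nu => [|n IH] x tau nu xB nu0 t0 t1.
  rewrite /rho /= (fib_sum nu (fun d k => \sum_i \sum_j x [::] d k i * tau [::] d j * g k i j)).
  apply: ler_sum => d _.
  rewrite -[leLHS]mul1r -(t1 [::] d) mulr_suml.
  apply: (@le_trans _ _ (\sum_j tau [::] d j * cost g (flow_of Qfib x (fib nu) [::]) d j)).
    by apply: ler_sum => j _; apply: ler_wpM2l => //; apply: fmin_le.
  rewrite le_eqVlt; apply/orP; left; apply/eqP.
  under eq_bigr => j _ do rewrite mulr_sumr.
  rewrite exchange_big; apply: eq_bigr => k _ /=.
  under eq_bigr => j _ do rewrite mulr_sumr.
  rewrite exchange_big mulr_sumr; apply: eq_bigr => i _ /=; rewrite mulr_sumr.
  by apply: eq_bigr => j _; rewrite /flow_of /=; ring.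
under eq_bigr => c _ do rewrite cond_payoffS.
pose G d j c' := cond_payoff (sigma_of (fun h => x (d :: h))) (fun h => tau ((d, j) :: h)) n
  (pt c') [::] [::].
rewrite -/(\sum_c nu c * (fun d k => \sum_i \sum_j x [::] d k i * tau [::] d j *
  \sum_c' q k i j (pt c') * G d j c') (dtil c) (ktil c)).
rewrite (fib_sum nu (fun d k => \sum_i \sum_j x [::] d k i * tau [::] d j *
  \sum_c' q k i j (pt c') * G d j c')).
apply: ler_sum => d _.
pose nu' j c' := \sum_(ki : K * I) (fib nu d ki.1 * x [::] d ki.1 ki.2) * q ki.1 ki.2 j (pt c').
have [x0 x1] := xB.
have nu'0 j c' : 0 <= nu' j c'.
  by apply: sumr_ge0 => ki _; rewrite !mulr_ge0 // fib_ge0.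
have E : \sum_k fib nu d k * (\sum_i \sum_j x [::] d k i * tau [::] d j *
    \sum_c' q k i j (pt c') * G d j c') = \sum_j tau [::] d j * \sum_c' nu' j c' * G d j c'.
  under [RHS]eq_bigr => j _ do rewrite mulr_sumr.
  under [RHS]eq_bigr => j _ do under eq_bigr => c' _ do rewrite mulr_suml mulr_sumr.
  under [RHS]eq_bigr => j _ do rewrite exchange_big /=.
  rewrite exchange_big /= -(pair_bigA _ (fun k i => \sum_j \sum_c' tau [::] d j *
    (fib nu d k * x [::] d k i * q k i j (pt c') * G d j c'))) /=.
  apply: eq_bigr => k _; rewrite mulr_sumr; apply: eq_bigr => i _; rewrite mulr_sumr.
  apply: eq_bigr => j _; rewrite !mulr_sumr; apply: eq_bigr => c' _; ring.
rewrite E -[leLHS]mul1r -(t1 [::] d) mulr_suml; apply: ler_sum => j _.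
apply: ler_wpM2l => //.
have P' : fib (nu' j) = nxt Qfib (fun d k i => fib nu d k * x [::] d k i) d.
  apply/funext => d'; apply/funext => k'; rewrite /nu' fib_lin /nxt.
  rewrite -(pair_bigA _ (fun k i => fib nu d k * x [::] d k i *
    fib (fun c' => q k i j (pt c')) d' k')) /=.
  by do 2 apply: eq_bigr => ? _; rewrite (q_fib _ _ j j0).
have := IH (fun h => x (d :: h)) (fun h => tau ((d, j) :: h)) (nu' j).
by rewrite P'; apply.
Qed.

Definition step_weight (sigma : seq (C * I) -> C -> I -> R) (f : seq D -> D -> J -> R)
    c d1 (x : I * J * C) :=
  (dtil c == d1)%:R * (sigma [::] c x.1.1 * f [::] d1 x.1.2 * q (ktil c) x.1.1 x.1.2 (pt x.2)).

(* The law of (player 2's signals, state, player 1's action) from the initial signal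
   [c], when player 2 plays [f]; the first stage is peeled off, as in [cond_payoff]. *)
Fixpoint strategy_flow sigma f c h : D -> K -> I -> R :=
  if h is d1 :: h' then fun d k i => \sum_x step_weight sigma f c d1 x *
    strategy_flow (fun h => sigma ((c, x.1.1) :: h)) (fun h => f (d1 :: h)) x.2 h' d k i
  else fun d k i => (dtil c == d)%:R * (ktil c == k)%:R * sigma [::] c i.

Lemma sum_step_weight sigma f c d1 (F : I -> J -> C -> R) :
  \sum_x step_weight sigma f c d1 x * F x.1.1 x.1.2 x.2 =
  (dtil c == d1)%:R * \sum_i \sum_j sigma [::] c i * f [::] d1 j *
    \sum_c' q (ktil c) i j (pt c') * F i j c'.
Proof.
rewrite -(pair_bigA _ (fun ij c' => step_weight sigma f c d1 (ij, c') * F ij.1 ij.2 c')) /=.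
rewrite -(pair_bigA _ (fun i j => \sum_c' step_weight sigma f c d1 (i, j, c') * F i j c')) /=.
rewrite mulr_sumr; apply: eq_bigr => i _; rewrite mulr_sumr; apply: eq_bigr => j _.
by rewrite !mulr_sumr; apply: eq_bigr => c' _; rewrite /step_weight /=; ring.
Qed.

Lemma strategy_flow_flow (sigma : seq (C * I) -> C -> I -> R) f c :
  (forall h c i, 0 <= sigma h c i) -> (forall h c, \sum_i sigma h c i = 1) -> behaviour2 f ->
  flow Qfib (fun d k => (dtil c == d)%:R * (ktil c == k)%:R) (strategy_flow sigma f c).
Proof.
move=> s0 s1 fB; have [f0 f1] := fB.
have root sigma' f' c' d k : (forall h c, \sum_i sigma' h c i = 1) ->
    marg (strategy_flow sigma' f' c' [::]) d k = (dtil c' == d)%:R * (ktil c' == k)%:R.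
  by move=> s1'; rewrite /marg -mulr_sumr s1' mulr1.
split=> [h|d k|h]; [|exact: root|].
  elim: h sigma f c s0 s1 f0 f1 {fB} => [|d1 h IH] sigma f c s0 s1 f0 f1 d k i.
    by rewrite /= !mulr_ge0.
  apply: sumr_ge0 => x _; rewrite mulr_ge0 //; first by rewrite !mulr_ge0.
  by apply: IH.
elim: h sigma f c s0 s1 f0 f1 {fB} => [|d1 h IH] sigma f c s0 s1 f0 f1 d d' k'.
  rewrite [LHS](marg_lin (step_weight sigma f c d) (fun x => strategy_flow (fun h => sigma ((c, x.1.1) :: h))
    (fun h => f (d :: h)) x.2 [::])).
  under eq_bigr => x _ do rewrite root //.
  rewrite (sum_step_weight sigma f c d (fun _ _ c' => (dtil c' == d')%:R * (ktil c' == k')%:R)).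
  rewrite /nxt.
  transitivity ((dtil c == d)%:R * \sum_i sigma [::] c i * Qfib (ktil c) i d' k').
    congr (_ * _); apply: eq_bigr => i _; rewrite -[RHS]mul1r -[X in _ = X * _](f1 [::] d) mulr_suml.
    apply: eq_bigr => j _; rewrite /Qfib (q_fib _ _ j0 j) /fib !mulr_sumr.
    by apply: eq_bigr => c1 _; ring.
  rewrite -(sum_delta (ktil c) (fun k => (dtil c == d)%:R * \sum_i sigma [::] c i * Qfib k i d' k')).
  by apply: eq_bigr => k _; rewrite !mulr_sumr; apply: eq_bigr => i _ /=; ring.
rewrite /= marg_lin nxt_lin; apply: eq_bigr => x _; congr (_ * _).
by rewrite IH.
Qed.

Lemma strategy_flow_pay n sigma f c :
  pay g f n (strategy_flow sigma f c) = cond_payoff sigma (tau_of f) n (pt c) [::] [::].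
Proof.
elim: n sigma f c => [|n IH] sigma f c.
  rewrite /pay /= exchange_big [RHS]exchange_big; apply: eq_bigr => j _ /=.
  transitivity (\sum_d (dtil c == d)%:R * (f [::] d j * \sum_i sigma [::] c i * g (ktil c) i j)).
    apply: eq_bigr => d _; rewrite /cost.
    rewrite -(sum_delta (ktil c) (fun k => (dtil c == d)%:R * (f [::] d j *
      \sum_i sigma [::] c i * g k i j))) mulr_sumr.
    by apply: eq_bigr => k _; rewrite !mulr_sumr; apply: eq_bigr => i _ /=; ring.
  rewrite sum_delta mulr_sumr; apply: eq_bigr => i _; rewrite /tau_of /=; ring.
rewrite cond_payoffS.
transitivity (\sum_d1 pay g (fun h => f (d1 :: h)) n (fun h => strategy_flow sigma f c (d1 :: h))).
  by [].
under eq_bigr => d1 _ do rewrite /= pay_lin.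
under eq_bigr => d1 _ do under eq_bigr => x _ do rewrite IH.
under eq_bigr => d1 _ do rewrite (sum_step_weight sigma f c d1 (fun i j c' =>
  cond_payoff (fun h => sigma ((c, i) :: h)) (tau_of (fun h => f (d1 :: h))) n (pt c') [::] [::])).
by rewrite sum_delta.
Qed.

Definition strategy1 (sigma : seq (C * I) -> C -> I -> R) :=
  (forall h c i, 0 <= sigma h c i) /\ (forall h c, \sum_i sigma h c i = 1).
Definition strategy2 (tau : seq (D * J) -> D -> J -> R) :=
  (forall h d j, 0 <= tau h d j) /\ (forall h d, \sum_j tau h d j = 1).

Hypothesis g01 : forall k i j, 0 <= g k i j <= 1.

Lemma avg01 (T : finType) (p F : T -> R) : (forall x, 0 <= p x) -> \sum_x p x = 1 ->
  (forall x, 0 <= F x <= 1) -> 0 <= \sum_x p x * F x <= 1.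
Proof.
move=> p0 p1 F01; apply/andP; split.
  by apply: sumr_ge0 => x _; rewrite mulr_ge0 //; case/andP: (F01 x).
rewrite -p1; apply: ler_sum => x _; rewrite ler_piMr //; by case/andP: (F01 x).
Qed.

Lemma cond_payoff01 sigma tau n x h1 h2 : strategy1 sigma -> strategy2 tau ->
  0 <= cond_payoff sigma tau n x h1 h2 <= 1.
Proof.
move=> [s0 s1] [t0 t1]; elim: n x h1 h2 => [|n IH] x h1 h2 /=;
  under eq_bigr => i _ do (under eq_bigr => j _ do rewrite -mulrA; rewrite -mulr_sumr);
  apply: avg01 => // i; apply: avg01 => // j.
exact: avg01.
Qed.

Variable pi : K * C * D -> R.
Hypothesis pi_ge0 : forall y, 0 <= pi y.
Hypothesis pi_sum : \sum_y pi y = 1.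
Hypothesis pi_E : forall y, y != pt y.1.2 -> pi y = 0.

Definition mean_payoff sigma tau n := \sum_y pi y * cond_payoff sigma tau n y [::] [::].

Lemma mean_payoff01 sigma tau n : strategy1 sigma -> strategy2 tau ->
  0 <= mean_payoff sigma tau n <= 1.
Proof. by move=> s1 s2; apply: avg01 => // y; apply: cond_payoff01. Qed.

Let P := fib (fun c => pi (pt c)).

Lemma informed_controller_guarantees : exists v, forall e, 0 < e ->
  exists (M : nat) (A : R) sigma tau, [/\ 0 <= A, strategy1 sigma, strategy2 tau &
  forall th B, (forall t, 0 <= th t) -> (forall N, \sum_(t < N) `|th t.+1 - th t| <= B) ->
  (forall N, \sum_(t < N) th t <= 1) ->
  (forall tau' T, strategy2 tau' ->
    (v - e) * \sum_(t < T) th t - M%:R * B <= \sum_(s < M + T) th s * mean_payoff sigma tau' s) /\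
  (forall sigma' T, strategy1 sigma' ->
    \sum_(s < T) th s * mean_payoff sigma' tau s <= v + e + A * B)].
Proof.
have P0 d k : 0 <= P d k by apply: fib_ge0.
have P1 : mass P = 1.
  rewrite mass_fib -pi_sum; under [RHS]eq_bigr => y _ do rewrite -[pi _]mulr1.
  by rewrite (sum_pt (fun=> 1)) //; apply: eq_bigr => c _; rewrite mulr1.
exists (vstar j0 Qfib g P) => e e0.
have [M [mu [flm muH]]] := player1_guarantee i0 j0 Qfib_ge0 Qfib_sum g01 P0 P1 e0.
have [A [f [A0 fB fH]]] := player2_guarantee i0 j0 Qfib_ge0 Qfib_sum g01 P0 P1 e0.
have xB := cond_action_behaviour i0 flm.
exists M, A, (sigma_of (cond_action i0 mu)), (tau_of f); split=> //.
- by case: xB => x0 x1; split=> *; rewrite /sigma_of.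
- by case: fB => f0 f1; split=> *; rewrite /tau_of.
move=> th B th0 thB th1; split=> [tau' T [t0 t1]|sigma' T [s0 s1]].
  apply: (le_trans (muH th B T th0 thB)); apply: ler_sum => s _; rewrite ler_wpM2l //.
  rewrite /mean_payoff sum_pt // -[in leLHS](flow_of_cond_action i0 flm); exact: sigma_of_guarantee.
pose nu h d k i := \sum_c pi (pt c) * strategy_flow sigma' f c h d k i.
have fln : flow Qfib P nu.
  apply: flow_ext (flow_lin (fun c => pi_ge0 (pt c)) (fun c => strategy_flow_flow c s0 s1 fB)).
  by move=> d k; apply: eq_bigr => c _; rewrite mulrC.
apply: le_trans (fH nu th B T fln th0 thB th1); apply: ler_sum => s _.
rewrite ler_wpM2l // /mean_payoff sum_pt // pay_lin.
by apply: ler_sum => c _; rewrite ler_wpM2l // strategy_flow_pay.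
Qed.

End InformedGame.

Local Open Scope R_scope.

Lemma fsumE (T : finType) (f : T -> R) : fsum f = (\sum_x f x)%R.
Proof.
have -> : (\sum_x f x = \sum_(x <- enum T) f x)%R by rewrite big_enum.
by rewrite /fsum; elim: (enum T) => [|x s IH] /=; rewrite ?big_nil ?big_cons // IH.
Qed.

Lemma is_distE (T : finType) (p : T -> R) : is_dist p ->
  (forall x, (0 <= p x)%R) /\ (\sum_x p x = 1)%R.
Proof. by move=> [p0 p1]; split=> [x|]; [apply/RleP | rewrite -fsumE]. Qed.

Lemma dist_is_dist (T : finType) (p : T -> R) : (forall x, (0 <= p x)%R) ->
  (\sum_x p x = 1)%R -> is_dist p.
Proof. by move=> p0 p1; split=> [x|]; [apply/RleP | rewrite fsumE]. Qed.

Lemma sum_f_R0_ord (u : nat -> R) N : sum_f_R0 u N = (\sum_(t < N.+1) u t)%R.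
Proof. by elim: N => [|N IH] /=; rewrite ?big_ord1 // big_ord_recr IH. Qed.

Section Transfer.
Variables (K I J C D : finType) (q : K -> I -> J -> (K * C * D)%type -> R) (g : K -> I -> J -> R).

Lemma W_cond_payoff sigma tau n x h1 h2 :
  W q g sigma tau n x h1 h2 = cond_payoff q g sigma tau n x h1 h2.
Proof.
elim: n x h1 h2 => [|n IH] x h1 h2 /=; rewrite fsumE; apply: eq_bigr => i _; rewrite fsumE;
  apply: eq_bigr => j _ //.
by rewrite fsumE; congr (_ * _)%R; apply: eq_bigr => y _; rewrite IH.
Qed.

Lemma stage_payoffE pi sigma tau n :
  stage_payoff q g pi sigma tau n = mean_payoff q g pi sigma tau n.
Proof. by rewrite /stage_payoff fsumE; apply: eq_bigr => y _; rewrite W_cond_payoff. Qed.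

Variables (ktil : C -> K) (dtil : C -> D).

Lemma prob_of_in_E (p : (K * C * D)%type -> R) y : is_dist p ->
  prob_of p (in_E ktil dtil) = 1 -> y != pt ktil dtil y.1.2 -> p y = 0.
Proof.
move=> /is_distE[p0 p1]; rewrite /prob_of fsumE => pE yE.
have : (\sum_x (p x - (if in_E ktil dtil x then p x else 0%R)) == 0)%R.
  by rewrite sumrB p1 pE subrr.
rewrite psumr_eq0 => [/allP /(_ y)|x _]; last first.
  by case: ifP => _; rewrite ?subrr ?subr0.
rewrite mem_index_enum => /(_ isT) /=; case: ifP => [/andP[/eqP e1 /eqP e2]|_]; last first.
  by rewrite subr0 => /eqP.
by case/eqP: yE; case: y e1 e2 => [[k c] d] /= -> ->.
Qed.

Lemma fib_q k i j d' k' : is_dist (q k i j) -> prob_of (q k i j) (in_E ktil dtil) = 1 ->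
  fib ktil dtil (fun c => q k i j (pt ktil dtil c)) d' k' = fsum (fun c : C => q k i j (k', c, d')).
Proof.
move=> qd qE; rewrite fsumE; apply: eq_bigr => c _.
case: eqP => [<-|nd]; last first.
  rewrite !mul0r (prob_of_in_E qd qE) //; apply/negP => /eqP [_ e]; exact: nd.
case: eqP => [<-|nk]; first by rewrite !mul1r.
rewrite mulr0 mul0r (prob_of_in_E qd qE) //; apply/negP => /eqP [e]; exact: nk.
Qed.

End Transfer.

Lemma Un_cv_bounded_series (u : nat -> R) b : (forall n, 0 <= u n) ->
  (forall N, sum_f_R0 u N <= b) -> Un_cv (fun N => sum_f_R0 u N) (series_sum u).
Proof.
move=> u0 ub; rewrite /series_sum; apply: epsilon_spec.
have gr : Un_growing (fun N => sum_f_R0 u N) by move=> n /=; have := u0 (S n); Lra.lra.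
have [|l Hl] := growing_cv _ gr; last by exists l.
by exists b => x [n ->].
Qed.

Lemma series_sum_ge (u : nat -> R) b N : (forall n, 0 <= u n) ->
  (forall N, sum_f_R0 u N <= b) -> sum_f_R0 u N <= series_sum u.
Proof.
move=> u0 ub; apply: growing_ineq; last exact: Un_cv_bounded_series ub.
by move=> n /=; have := u0 (S n); Lra.lra.
Qed.

Lemma series_sum_le (u : nat -> R) b : (forall n, 0 <= u n) ->
  (forall N, sum_f_R0 u N <= b) -> series_sum u <= b.
Proof.
move=> u0 ub; apply: (@Rle_cv_lim _ (fun=> b) _ _ ub (Un_cv_bounded_series u0 ub)).
by move=> e e0; exists 0%N => n _; rewrite Rdist_eq.
Qed.

Lemma sup_R_lub (P : R -> Prop) b : (exists x, P x) -> (forall x, P x -> x <= b) ->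
  is_lub P (sup_R P).
Proof.
move=> ne ub; apply: epsilon_spec.
by have [|l Hl] := completeness P _ ne; [exists b | exists l].
Qed.

Lemma inf_R_glb (P : R -> Prop) b : (exists x, P x) -> (forall x, P x -> b <= x) ->
  (forall x, P x -> inf_R P <= x) /\ (forall c, (forall x, P x -> c <= x) -> c <= inf_R P).
Proof.
move=> [x0 Px0] lb.
have [||ub lst] := @sup_R_lub (fun x => P (- x)) (- b).
- by exists (- x0); rewrite Ropp_involutive.
- by move=> x /lb; Lra.lra.
split=> [x Px|c cP]; rewrite /inf_R.
  by have := ub (- x); rewrite Ropp_involutive => /(_ Px); Lra.lra.
suff : sup_R (fun x => P (- x)) <= - c by Lra.lra.
by apply: lst => x /cP; Lra.lra.
Qed.

Lemma evaluation_sum_le theta N : is_evaluation theta -> sum_f_R0 theta N <= 1.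
Proof.
move=> [th0 thc]; apply: (growing_ineq _ _ _ thc).
by move=> n /=; have := th0 (S n); Lra.lra.
Qed.

Lemma evaluation_tv_bounded theta N : is_evaluation theta ->
  sum_f_R0 (fun n => Rabs (theta (S n) - theta n)) N <= 2.
Proof.
move=> ev; have [th0 _] := ev.
suff : sum_f_R0 (fun n => Rabs (theta (S n) - theta n)) N <=
    sum_f_R0 theta N + sum_f_R0 theta (S N).
  have := evaluation_sum_le N ev; have := evaluation_sum_le (S N) ev; Lra.lra.
elim: N => [|N IH] /=.
  have := th0 0%N; have := th0 1%N; split_Rabs; Lra.lra.
move: IH => /=; have := th0 (S N); have := th0 (S (S N)); split_Rabs; Lra.lra.
Qed.

Theorem theorem7 (K I J C D : finType) (k0 : K) (i0 : I) (j0 : J) (c0 : C) (d0 : D)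
    (q : K -> I -> J -> (K * C * D)%type -> R) (g : K -> I -> J -> R)
    (Hq : forall k i j, is_dist (q k i j))
    (Hg : forall k i j, 0 <= g k i j <= 1)
    (ktil : C -> K) (dtil : C -> D)
    (Hass1 : forall k i j, prob_of (q k i j) (in_E ktil dtil) = 1)
    (Hass2 : forall k i j j' k' d',
        fsum (fun c : C => q k i j (k', c, d')) = fsum (fun c : C => q k i j' (k', c, d')))
    (pi : (K * C * D)%type -> R) (Hpi : is_dist pi)
    (HpiE : prob_of pi (in_E ktil dtil) = 1) :
  exists vstar : R, forall eps : R, 0 < eps ->
    exists alpha : R, 0 < alpha /\
    exists sigma : strat1 I C, is_strat1 sigma /\
    exists tau : strat2 J D, is_strat2 tau /\
    forall theta : nat -> R, is_evaluation theta -> total_variation theta <= alpha ->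
      Rabs (value q g theta pi - vstar) <= eps /\
      (forall tau' : strat2 J D, is_strat2 tau' -> gamma q g theta pi sigma tau' >= vstar - eps) /\
      (forall sigma' : strat1 I C, is_strat1 sigma' -> gamma q g theta pi sigma' tau <= vstar + eps).
Proof.
have strat1E (sigma : strat1 I C) : is_strat1 sigma -> strategy1 sigma.
  by move=> s1; split=> h c; case: (is_distE (s1 h c)).
have strat2E (tau : strat2 J D) : is_strat2 tau -> strategy2 tau.
  by move=> s2; split=> h d; case: (is_distE (s2 h d)).
have q_fib k i j j' d' k' : fib ktil dtil (fun c => q k i j (pt ktil dtil c)) d' k' =
    fib ktil dtil (fun c => q k i j' (pt ktil dtil c)) d' k'.
  by rewrite !fib_q.
have g01 k i j : (0 <= g k i j <= 1)%R.
  by have [/RleP g0 /RleP g1] := Hg k i j; apply/andP.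
have [pi0 pi1] := is_distE Hpi.
have [v Hv] := @informed_controller_guarantees R K I J C D i0 j0 q g ktil dtil
  (fun k i j => proj1 (is_distE (Hq k i j))) (fun k i j => proj2 (is_distE (Hq k i j)))
  (fun k i j y => prob_of_in_E (Hq k i j) (Hass1 k i j)) q_fib g01 pi pi0 pi1
  (fun y => prob_of_in_E Hpi HpiE).
exists v => eps eps0.
have eps2 : 0 < eps / 2 by Lra.lra.
have [M [A [sigma [tau [/RleP A0 [s0 s1] [t0 t1] H]]]]] := Hv _ (introT (@RltP _ _) eps2).
have M0 := pos_INR M; have {}A0 : 0 <= A := A0.
exists (eps / (2 * (INR M + A + 1))).
set alpha := eps / _.
have alphaE : alpha * (INR M + A + 1) = eps / 2 by rewrite /alpha /Rdiv Rinv_mult !Rmult_assoc Rinv_l ?Rmult_1_r //; Lra.lra.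
have alpha0 : 0 < alpha by apply: Rdiv_lt_0_compat; Lra.lra.
have alphaM : INR M * alpha <= eps / 2 by Psatz.nra.
have alphaA : A * alpha <= eps / 2 by Psatz.nra.
split=> //; exists sigma; split; first by move=> h c; apply: dist_is_dist.
exists tau; split; first by move=> h d; apply: dist_is_dist.
move=> theta ev tv; have [th0 thc] := ev.
have thB N : (\sum_(t < N) `|theta t.+1 - theta t| <= alpha)%R.
  apply/RleP; case: N => [|N]; first by rewrite big_ord0; apply: Rlt_le.
  rewrite -(sum_f_R0_ord (fun t => Rabs (theta t.+1 - theta t))).
  apply: Rle_trans tv; apply: (@series_sum_ge _ 2) => [n|n]; first exact: Rabs_pos.
  exact: evaluation_tv_bounded.
have th1 N : (\sum_(t < N) theta t <= 1)%R.
  apply/RleP; case: N => [|N]; first by rewrite big_ord0; apply: Rlt_le; apply: Rlt_0_1.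
  by rewrite -sum_f_R0_ord; apply: evaluation_sum_le.
have [H1 H2] := H theta alpha (fun t => introT (@RleP _ _) (th0 t)) thB th1.
have stage1 sg ta n : is_strat1 sg -> is_strat2 ta -> 0 <= stage_payoff q g pi sg ta n <= 1.
  move=> /strat1E s /strat2E t; rewrite stage_payoffE.
  have /andP[/RleP a /RleP b] := mean_payoff01 (fun k i j => proj1 (is_distE (Hq k i j)))
    (fun k i j => proj2 (is_distE (Hq k i j))) g01 pi0 pi1 n s t.
  by split.
have u0 sg ta n : is_strat1 sg -> is_strat2 ta -> 0 <= theta n * stage_payoff q g pi sg ta n.
  by move=> s t; apply: Rmult_le_pos => //; case: (stage1 sg ta n s t).
have u1 sg ta N : is_strat1 sg -> is_strat2 ta ->
    sum_f_R0 (fun n => theta n * stage_payoff q g pi sg ta n) N <= 1.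
  move=> s t; apply: Rle_trans (evaluation_sum_le N ev); apply: sum_Rle => n _.
  rewrite -[X in _ <= X]Rmult_1_r; apply: Rmult_le_compat_l => //.
  by case: (stage1 sg ta n s t).
have gm0 sg ta : is_strat1 sg -> is_strat2 ta -> 0 <= gamma q g theta pi sg ta.
  move=> s t; apply: Rle_trans (u0 sg ta 0%N s t) _.
  by apply: (@series_sum_ge _ 1 0%N) => n; [apply: u0 | apply: u1].
have gm1 sg ta : is_strat1 sg -> is_strat2 ta -> gamma q g theta pi sg ta <= 1.
  by move=> s t; apply: series_sum_le => n; [apply: u0 | apply: u1].
have sS : is_strat1 sigma by move=> h c; apply: dist_is_dist.
have tS : is_strat2 tau by move=> h d; apply: dist_is_dist.
have lower ta : is_strat2 ta -> v - eps <= gamma q g theta pi sigma ta.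
  move=> t.
  have bound T : (v - eps / 2) * sum_f_R0 theta T - INR M * alpha <= gamma q g theta pi sigma ta.
    apply: (@Rle_trans _ (sum_f_R0 (fun n => theta n * stage_payoff q g pi sigma ta n) (M + T)%N)).
      rewrite !sum_f_R0_ord; apply/RleP.
      have := H1 ta T.+1 (strat2E _ t); rewrite -INRE addnS.
      under [X in (_ <= X)%R -> _]eq_bigr => n _ do rewrite -stage_payoffE.
      by [].
    by apply: (@series_sum_ge _ 1) => n; [apply: u0 | apply: u1].
  have cst (c : R) : Un_cv (fun=> c) c by move=> e e0; exists 0%N => n _; rewrite Rdist_eq.
  have := Rle_cv_lim bound (CV_minus _ _ _ _ (CV_mult _ _ _ _ (cst _) thc) (cst _)) (cst _).
  by Lra.lra.
have upper sg : is_strat1 sg -> gamma q g theta pi sg tau <= v + eps.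
  move=> s; apply: series_sum_le => [n|N]; first exact: u0.
  rewrite sum_f_R0_ord; have /RleP := H2 sg N.+1 (strat1E _ s).
  under eq_bigr => n _ do rewrite -stage_payoffE.
  move=> h; apply: (Rle_trans _ (v + eps / 2 + A * alpha) _ h).
  by Lra.lra.
split; last by split=> [ta t|sg s]; [apply/Rle_ge/lower | exact: upper].
have infE sg : is_strat1 sg ->
    (forall ta, is_strat2 ta -> inf_R (fun w => exists tau0, is_strat2 tau0 /\
      w = gamma q g theta pi sg tau0) <= gamma q g theta pi sg ta) /\
    (forall c, (forall ta, is_strat2 ta -> c <= gamma q g theta pi sg ta) ->
      c <= inf_R (fun w => exists tau0, is_strat2 tau0 /\ w = gamma q g theta pi sg tau0)).
  move=> s; have [||lo hi] := @inf_R_glb (fun w => exists tau0, is_strat2 tau0 /\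
      w = gamma q g theta pi sg tau0) 0.
  - by exists (gamma q g theta pi sg tau), tau.
  - by move=> _ [ta [t ->]]; apply: gm0.
  split=> [ta t|c cH]; first by apply: lo; exists ta.
  by apply: hi => _ [ta [t ->]]; apply: cH.
have [||ub lst] := @sup_R_lub (fun w => exists sg, is_strat1 sg /\
    w = inf_R (fun w => exists tau0, is_strat2 tau0 /\ w = gamma q g theta pi sg tau0)) 1.
- by eexists; exists sigma.
- move=> _ [sg [s ->]]; have [lo _] := infE sg s.
  exact: Rle_trans (lo tau tS) (gm1 sg tau s tS).
have val_hi : value q g theta pi <= v + eps.
  apply: lst => _ [sg [s ->]]; have [lo _] := infE sg s.
  exact: Rle_trans (lo tau tS) (upper sg s).
have val_lo : v - eps <= value q g theta pi.
  have [_ hi] := infE sigma sS; apply: Rle_trans (hi _ lower) _.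
  by apply: ub; exists sigma.
by apply: Rabs_le; Lra.lra.
Qed.
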